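(* Let $I$ be an image of size $H\times W\times n_0$ with mesh size $h>0$ and latent functions $r_1,\dots,r_{n_0}:\mathbb{R}^2\to\mathbb{R}$. Let $\mathrm{g}$ be an $N$-layer rotation-translation equivariant CNN with rotation group $S=\{A_{2\pi k/t}: k=1,\dots,t\}$ (so $|S|=t$), filter size $p$, ReLU activation, and $i$-th layer channel number $n_i$ (all as defined in the context). Suppose there are constants $F_i,G_i,H_i$ ($i=0,1,\dots,N$), with $F_i>0$ for $i\ge 1$, such that for every $x\in\mathbb{R}^2$, every $c\in\{1,\dots,n_0\}$, every $i\in\{1,\dots,N\}$, and every filter function $\varphi^i$ of the $i$-th layer, $$|r_c(x)|\le F_0,\quad \|\nabla r_c(x)\|\le G_0,\quad \|\nabla^2 r_c(x)\|\le H_0,$$ $$|\varphi^i(x)|\le F_i,\quad \|\nabla \varphi^i(x)\|\le G_i,\quad \|\nabla^2 \varphi^i(x)\|\le H_i,$$ $$\varphi^i(x)=0\ \text{ whenever } \|x\|\ge \tfrac{(p+1)h}{2}.$$ Then for every $\theta\in[0,2\pi]$ and every $b\in\mathbb{R}^2$, with $f=f_{\theta b}$ the rotation-translation transformation defined in the context, $$\big\| f^{-1}\big(\mathrm{g}(f(I))\big)-\mathrm{g}(I)\big\|_\infty\ \le\ C_1h^2+C_2\,p\,h\,t^{-1},$$ where $$C_1=2N\mathcal{F}\sum_{i=1}^{N}\left(\frac{H_iF_0}{F_i}+2\frac{G_i}{F_i}\sum_{m=1}^{i-1}\frac{G_mF_0}{F_m}+2\frac{G_iG_0}{F_i}+H_0\right),$$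 $$C_2=2\pi G_0\mathcal{F}\left(2\max\{H,W\}\,p^{-1}+2N\right),\qquad \mathcal{F}=\prod_{i=1}^{N}n_{i-1}p^2F_i .$$
   Context: **Grids and images.** $H,W,p,t,n_0$ are positive integers, $h>0$, and $N\ge 2$. Image grid points are $x_{kl}=\left((k-\frac{H+1}{2})h,(l-\frac{W+1}{2})h\right)^T$, $1\le k\le H$, $1\le l\le W$. Filter grid points form the set $\Lambda=\left\{\left((k-\frac{p+1}{2})h,(l-\frac{p+1}{2})h\right)^T: k,l=1,\dots,p\right\}$. An image $I$ of size $H\times W\times n_0$ is obtained by sampling smooth functions $r_c:\mathbb{R}^2\to\mathbb{R}$ (its latent functions): $I^c_{kl}=r_c(x_{kl})$. All operations below are defined through latent functions on $\mathbb{R}^2$, and the resulting arrays are their samples on the grid $\{x_{kl}\}$. Here $\|\cdot\|$ is the Euclidean norm of vectors and the induced operator norm of matrices; $\nabla$ and $\nabla^2$ are the gradient and Hessian. **Rotations.** $A_\theta=\begin{bmatrix}\cos\theta&-\sin\theta\\ \sin\theta&\cos\theta\end{bmatrix}$ and $S=\{A_{2\pi k/t}:k=1,\dots,t\}$. **The network $\mathrm{g}$.** It consists of one input layer (layer 1), $N-2$ intermediate layers (layers $2,\dots,N-1$) and one output layer (layer $N$), with the ReLU function $\max(\cdot,0)$ applied pointwise between consecutive layers. Each hidden layer $i\in\{1,\dots,N-1\}$ produces latent functions $e^i_d:\mathbb{R}^2\times S\to\mathbb{R}$, $d=1,\dots,m_i$; its channel number is $n_i=t\,m_i$ (pairs of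 a group element and an index $d$). The filter functions, smooth functions $\mathbb{R}^2\to\mathbb{R}$, are $\varphi^1_{cd}$ for layer 1, $\varphi^i_{Acd}$ ($A\in S$) for layers $2\le i\le N-1$, and $\varphi^N_{cd}$ for layer $N$. The layers are: - Input layer: $e^1_d(x,B)=\sum_{c}\sum_{\delta\in\Lambda}\varphi^1_{cd}(B^{-1}\delta)\,r_c(x-\delta)$. - Intermediate layer $i$: $e^i_d(x,B)=\sum_{c}\sum_{A\in S}\sum_{\delta\in\Lambda}\varphi^i_{Acd}(B^{-1}\delta)\,e^{i-1}_c(x-\delta,BA)$, where $e^{i-1}_c$ on the right is taken after ReLU. - Output layer: $\hat r_d(x)=\sum_{c}\sum_{B\in S}\sum_{\delta\in\Lambda}\varphi^N_{cd}(B^{-1}\delta)\,e^{N-1}_c(x-\delta,B)$, $d=1,\dots,n_N$, where $e^{N-1}_c$ is taken after ReLU. The output $\mathrm{g}(I)$ is the array $\hat r_d(x_{kl})$, with latent functions $\hat r_d$. **The transformation.** For $\theta\in[0,2\pi]$ and $b\in\mathbb{R}^2$, $f_{\theta b}$ acts on a latent function $r:\mathbb{R}^2\to\mathbb{R}$ by $f_{\theta b}[r](x)=r(A_\theta^{-1}(x-b))$, so $f_{\theta b}^{-1}[r](x)=r(A_\theta x+b)$. It acts on a sampled array (an image, or the output of $\mathrm{g}$) channel by channel: apply the transformation to the latent functions and sample at the points $x_{kl}$. The input of $\mathrm{g}$ in $\mathrm{g}(f(I))$ has latent functions $f_{\theta b}[r_c]$, and $f^{-1}(\mathrm{g}(f(I)))$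 is obtained by applying $f_{\theta b}^{-1}$ to the latent functions of $\mathrm{g}(f(I))$ and sampling. $\|\cdot\|_\infty$ is the maximum absolute value over all grid positions and channels. *)

(* Defs.v *)
From HB Require Import structures.
From mathcomp Require Import all_boot all_order all_algebra.
From mathcomp Require Import all_classical all_reals all_analysis.

Set Implicit Arguments.
Unset Strict Implicit.
Unset Printing Implicit Defensive.

Import Order.TTheory GRing.Theory Num.Theory.
Import numFieldNormedType.Exports.

Local Open Scope classical_set_scope.
Local Open Scope ring_scope.

(* The library norm on 'cV[R]_n is the sup norm; the Euclidean one is needed. *)
Definition enorm (R : realType) (n : nat) (v : 'cV[R]_n) : R :=
  Num.sqrt (\sum_(i < n) v i 0 ^+ 2).

Definition opnorm (R : realType) (m n : nat) (M : 'M[R]_(m, n)) : R :=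
  sup [set enorm (M *m v) | v in [set v : 'cV[R]_n | enorm v <= 1]].

Definition partial (R : realType) (i : 'I_2) (f : 'cV[R]_2 -> R)
    (x : 'cV[R]_2) : R :=
  'D_(delta_mx i 0) f x.

Definition gradient (R : realType) (f : 'cV[R]_2 -> R) (x : 'cV[R]_2) :
    'cV[R]_2 :=
  \col_i partial i f x.

Definition hessian (R : realType) (f : 'cV[R]_2 -> R) (x : 'cV[R]_2) :
    'M[R]_2 :=
  \matrix_(i, j) partial i (partial j f) x.

Fixpoint Cn (R : realType) (n : nat) (f : 'cV[R]_2 -> R) : Prop :=
  if n is n'.+1 then
    (forall x : 'cV[R]_2, differentiable f x) /\
    (forall i : 'I_2, Cn n' (partial i f))
  else continuous f.

Definition smooth (R : realType) (f : 'cV[R]_2 -> R) : Prop :=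
  forall n : nat, Cn n f.

Definition rot (R : realType) (theta : R) : 'M[R]_2 :=
  \matrix_(i, j) (nth [::] [:: [:: cos theta; - sin theta];
                               [:: sin theta;   cos theta]] i)`_j.

Definition rotgrp (R : realType) (t : nat) : set 'M[R]_2 :=
  [set rot (2 * pi * k%:R / t%:R) | k in [set k : nat | (1 <= k <= t)%N]].

Arguments rotgrp R t : clear implicits.

(* 1-based indices: 1 <= k <= H and 1 <= l <= W. *)
Definition gridpt (R : realType) (h : R) (H W k l : nat) : 'cV[R]_2 :=
  \col_i [:: (k%:R - H.+1%:R / 2) * h; (l%:R - W.+1%:R / 2) * h]`_i.

Definition filter_grid (R : realType) (h : R) (p : nat) : set 'cV[R]_2 :=
  [set gridpt h p p k l | k in [set k : nat | (1 <= k <= p)%N]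
                        & l in [set l : nat | (1 <= l <= p)%N]].

(* Finiteness ensures that [\sum_(A \in rotgrp R t)] and
   [\sum_(delta \in filter_grid h p)] are the actual sums, not the junk
   value 0 taken by [\sum_(_ \in _)] on infinite supports. *)
Lemma finite_rotgrp (R : realType) (t : nat) : finite_set (rotgrp R t).
Proof.
apply: finite_image; apply: (sub_finite_set _ (finite_II t.+1)) => k /=.
by rewrite ltnS => /andP[].
Qed.

Lemma finite_filter_grid (R : realType) (h : R) (p : nat) :
  finite_set (filter_grid h p).
Proof.
have fin : finite_set [set k : nat | (1 <= k <= p)%N].
  apply: (sub_finite_set _ (finite_II p.+1)) => k /=.
  by rewrite ltnS => /andP[].
exact: finite_image2.
Qed.

Definition relu (R : realType) (x : R) : R := Num.max x 0.

(* Filters of an N-layer network with n0 input and nN output channels.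
   [mult i] is m_i for the hidden layers 1 <= i <= N - 1 and is irrelevant
   otherwise. [phi_mid j] holds the filters of layer j + 2, which go from
   layer j + 1 to layer j + 2; only the values j < N - 2 and arguments in
   [rotgrp R t] matter. Since N >= 2, the index [N.-2.+1] is N - 1. *)
Record eqcnn (R : realType) (N n0 nN : nat) := EqCNN {
  mult : nat -> nat;
  phi_in : 'I_n0 -> 'I_(mult 1) -> 'cV[R]_2 -> R;
  phi_mid : forall j : nat,
    'M[R]_2 -> 'I_(mult j.+1) -> 'I_(mult j.+2) -> 'cV[R]_2 -> R;
  phi_out : 'I_(mult N.-2.+1) -> 'I_nN -> 'cV[R]_2 -> R
}.

Arguments phi_in {R N n0 nN} net c d : rename.
Arguments phi_mid {R N n0 nN} net j A c d : rename.
Arguments phi_out {R N n0 nN} net c d : rename.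

Inductive filter_of (R : realType) (N n0 nN : nat) (t : nat)
    (net : eqcnn R N n0 nN) : nat -> ('cV[R]_2 -> R) -> Prop :=
| filter_in c d : filter_of t net 1 (phi_in net c d)
| filter_mid j A c d : (j.+2 < N)%N -> rotgrp R t A ->
    filter_of t net j.+2 (phi_mid net j A c d)
| filter_out c d : filter_of t net N (phi_out net c d).

Definition nchan (R : realType) (N n0 nN : nat) (t : nat)
    (net : eqcnn R N n0 nN) (i : nat) : nat :=
  if i == 0%N then n0 else (t * mult net i)%N.

(* [feature h p t net r j] is the pre-activation output e^(j+1) of hidden
   layer j + 1. *)
Fixpoint feature (R : realType) (N n0 nN : nat) (h : R) (p t : nat)
    (net : eqcnn R N n0 nN) (r : 'I_n0 -> 'cV[R]_2 -> R) (j : nat) :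
    'I_(mult net j.+1) -> 'cV[R]_2 -> 'M[R]_2 -> R :=
  match j with
  | 0 => fun d x B =>
      \sum_(c < n0) \sum_(delta \in filter_grid h p)
        phi_in net c d (invmx B *m delta) * r c (x - delta)
  | k.+1 => fun d x B =>
      \sum_(c < mult net k.+1) \sum_(A \in rotgrp R t)
        \sum_(delta \in filter_grid h p)
          phi_mid net k A c d (invmx B *m delta) *
          relu (@feature R N n0 nN h p t net r k c (x - delta) (B *m A))
  end.

Arguments feature {R N n0 nN} h p t net r j d x B : rename.

Definition output (R : realType) (N n0 nN : nat) (h : R) (p t : nat)
    (net : eqcnn R N n0 nN) (r : 'I_n0 -> 'cV[R]_2 -> R)
    (d : 'I_nN) (x : 'cV[R]_2) : R :=
  \sum_(c < mult net N.-2.+1) \sum_(B \in rotgrp R t)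
    \sum_(delta \in filter_grid h p)
      phi_out net c d (invmx B *m delta) *
      relu (feature h p t net r N.-2 c (x - delta) B).

Definition transf (R : realType) (theta : R) (b : 'cV[R]_2)
    (r : 'cV[R]_2 -> R) (x : 'cV[R]_2) : R :=
  r (invmx (rot theta) *m (x - b)).

Definition transf_inv (R : realType) (theta : R) (b : 'cV[R]_2)
    (r : 'cV[R]_2 -> R) (x : 'cV[R]_2) : R :=
  r (rot theta *m x + b).

Definition image_of (R : realType) (H W n : nat) (h : R)
    (r : 'I_n -> 'cV[R]_2 -> R) : {ffun 'I_H * 'I_W * 'I_n -> R} :=
  [ffun q : 'I_H * 'I_W * 'I_n =>
    r q.2 (gridpt h H W q.1.1.+1 q.1.2.+1)].

Definition maxnorm (R : realType) (T : finType) (I : {ffun T -> R}) : R :=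
  \big[Num.max/0]_(q : T) `|I q|.

Definition calF (R : realType) (N n0 nN : nat) (p t : nat)
    (net : eqcnn R N n0 nN) (F : nat -> R) : R :=
  \prod_(1 <= i < N.+1) ((nchan t net i.-1)%:R * p%:R ^+ 2 * F i).

Definition const1 (R : realType) (N n0 nN : nat) (p t : nat)
    (net : eqcnn R N n0 nN) (F G Hs : nat -> R) : R :=
  2 * N%:R * calF p t net F *
  \sum_(1 <= i < N.+1)
    (Hs i * F 0%N / F i
     + 2 * (G i / F i) * (\sum_(1 <= m < i) G m * F 0%N / F m)
     + 2 * (G i * G 0%N / F i)
     + Hs 0%N).

Definition const2 (R : realType) (N n0 nN : nat) (H W p t : nat)
    (net : eqcnn R N n0 nN) (F G : nat -> R) : R :=
  2 * pi * G 0%N * calF p t net F *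
  (2 * (maxn H W)%:R * p%:R^-1 + 2 * N%:R).

(* Main.v *)
(** Translations commute exactly with the network, and a rotation by an element
    K of the rotation group would commute with it if the sum over the filter
    grid were an integral.  Two facts quantify the discrepancy of one layer.

    - Quadrature.  Up to O(h^2), sum psi(K v) and sum psi(v) over the grid
      agree, for psi(y) = phi(y) u(x - y).  Both are averaged against each
      other: in the double sum of psi(a + K b) over the two lattices, with a
      slowly varying radial weight put on a or on b, each inner sum is a shifted
      lattice sum.  Shifting a lattice sum costs interpolation errors, which are
      bounded by the variation of the slopes of psi along lines.

    - ReLU.  Features are not C^2, but along a line the variation of their
      slopes is at most H L + 2 G on a segment of length L, as it is for the
      latent functions: for slopes extended by 0 it is twice the sum of the
      negative parts of the second differences, which relu does not increase
      since it is convex and nondecreasing.  The extra 2 G is absorbed since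
      phi vanishes on the boundary of its support, so that |phi| <= G_i rho.

    A general angle is replaced by the nearest one of the group at the price of
    the Lipschitz constant of the features, and the errors are summed over the
    layers. *)

Require Import Defs.
From mathcomp Require Import all_boot all_order all_algebra.
From mathcomp Require Import all_classical all_reals all_analysis.
From mathcomp Require Import ring lra zify.

Set Implicit Arguments.
Unset Strict Implicit.
Unset Printing Implicit Defensive.

Import Order.TTheory GRing.Theory Num.Theory.
Import numFieldNormedType.Exports.

Local Open Scope classical_set_scope.
Local Open Scope ring_scope.

Local Notation rot := Defs.rot.

(** * Shifts of one- and two-dimensional lattice sums *)

(** Error at y of the chord of f over the cell of length h that contains y at relative position
    [la]. *)
Definition interp_defect {R : realType} (f : R -> R) (h la y : R) : R :=
  f y - ((1 - la) * f (y - la * h) + la * f (y + (1 - la) * h)).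

Definition interp_var {R : realType} (f : R -> R) (h : R) (m : nat)
    (e : R) : Prop :=
  forall y la : R, 0 <= la -> la <= 1 ->
  \sum_(k < m) `|interp_defect f h la (y + k%:R * h)| <= e.

Definition off_interval {R : realType} (a b : R) (f : R -> R) : Prop :=
  forall x, x <= a \/ b <= x -> f x = 0.

Lemma sum_ord_widen_eq0 {V : zmodType} (F : nat -> V) (m n : nat) :
  (m <= n)%N -> (forall k, (m <= k)%N -> F k = 0) ->
  \sum_(k < n) F k = \sum_(k < m) F k.
Proof.
move=> mn F0; rewrite -!(big_mkord xpredT F) (big_cat_nat _ mn) //=.
rewrite [X in _ + X]big_nat_cond [X in _ + X]big1 ?addr0 //.
by move=> k /andP[/andP[mk _] _]; exact: F0.
Qed.

(** The window start [c'] is chosen before f, so that one window serves every row or column of a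
    two-dimensional sum. *)
Lemma lattice_sum_window {R : realType} (al h c : R) (n p : nat) :
  0 < h -> c <= al -> al + p.+1%:R * h <= c + n%:R * h ->
  exists2 c' : R, al - h < c' <= al &
  forall f : R -> R, off_interval al (al + p.+1%:R * h) f ->
  \sum_(k < n) f (c + k%:R * h) = \sum_(k < p.+2) f (c' + k%:R * h).
Proof.
move=> h0 cal cn.
have z0 : 0 <= (al - c) / h by rewrite divr_ge0 ?subr_ge0 // ltW.
(* Node j is the last one at or before [al]. From there p + 2 nodes cover the open interval, since
   the next one lies beyond its right end. *)
have /andP[] := truncn_itv z0; set j := Num.truncn _ => jle jgt.
have jle' : j%:R * h <= al - c by rewrite -ler_pdivlMr.
have jgt' : al - c < j.+1%:R * h by rewrite -ltr_pdivrMr.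
exists (c + j%:R * h).
  by move: jgt'; rewrite -natr1 mulrDl mul1r => ?; apply/andP; split; lra.
move=> f f0.
pose F k := f (c + k%:R * h).
have F1 k : (j + p.+2 <= k)%N -> F k = 0.
  move=> jk; apply: f0; right.
  have : (j + p.+2)%:R * h <= k%:R * h by rewrite ler_pM2r // ler_nat.
  have -> : (j + p.+2)%:R = j.+1%:R + p.+1%:R :> R.
    by rewrite -natrD addSnnS.
  by rewrite mulrDl; lra.
have F2 k : (n <= k)%N -> F k = 0.
  move=> jk; apply: f0; right.
  have : n%:R * h <= k%:R * h by rewrite ler_pM2r // ler_nat.
  by lra.
transitivity (\sum_(k < n + (j + p.+2)) F k).
  by symmetry; apply: sum_ord_widen_eq0; rewrite ?leq_addr.
rewrite (@sum_ord_widen_eq0 _ F (j + p.+2) (n + (j + p.+2))) ?leq_addl //.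
rewrite big_split_ord /= big1 ?add0r => [|k _]; last first.
  apply: f0; left.
  have : k.+1%:R * h <= j%:R * h by rewrite ler_pM2r // ler_nat.
  by rewrite -natr1 mulrDl; lra.
by apply: eq_bigr => k _; rewrite /F natrD mulrDl addrA.
Qed.

(* The shifted sum is a sum of convex combinations of consecutive nodes:
   the weights telescope because f vanishes at both ends. *)
Lemma lattice_shift {R : realType} (f : R -> R) (al h c e : R) (p : nat) :
  0 < h -> off_interval al (al + p.+1%:R * h) f ->
  interp_var f h p.+2 e -> al - h < c <= al ->
  `|\sum_(k < p.+2) f (c + k%:R * h) -
    \sum_(k < p.+2) f (al + k%:R * h)| <= e.
Proof.
move=> h0 f0 fe /andP[c1 c2].
pose la := (al - c) / h.
have lah : la * h = al - c by rewrite /la divfK // gt_eqF.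
have la0 : 0 <= la by rewrite divr_ge0 ?subr_ge0 // ltW.
have la1 : la <= 1 by rewrite ler_pdivrMr //; lra.
have tel : \sum_(k < p.+2) (f (c + k.+1%:R * h) - f (c + k%:R * h)) = 0.
  rewrite -(big_mkord xpredT
    (fun k : nat => f (c + k.+1%:R * h) - f (c + k%:R * h))).
  rewrite (telescope_sumr (fun k : nat => f (c + k%:R * h))) //.
  rewrite mul0r addr0 [f c]f0; last by left.
  rewrite f0 ?subr0 //; right.
  by rewrite -natr1 mulrDl; lra.
apply: le_trans (fe al la la0 la1).
rewrite -normrN opprB.
have -> : \sum_(k < p.+2) f (al + k%:R * h) -
    \sum_(k < p.+2) f (c + k%:R * h) =
    \sum_(k < p.+2) interp_defect f h la (al + k%:R * h).
  have z : \sum_(k < p.+2) la * (f (c + k.+1%:R * h) - f (c + k%:R * h)) = 0.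
    by rewrite -mulr_sumr tel mulr0.
  rewrite -[LHS]subr0 -[X in _ - X = _]z -!sumrB.
  apply: eq_bigr => k _; rewrite /interp_defect.
  have -> : al + k%:R * h - la * h = c + k%:R * h by rewrite lah; ring.
  have -> : al + k%:R * h + (1 - la) * h = c + k.+1%:R * h.
    by rewrite mulrBl lah -natr1; ring.
  by ring.
exact: ler_norm_sum.
Qed.

(** The two coordinates are shifted one after the other. Each shift acts on p + 2 parallel lines and
    costs e on each of them. *)
Lemma lattice_shift2 {R : realType} (f : R -> R -> R) (al h e : R)
    (p n : nat) (c1 c2 : R) :
  0 < h ->
  (forall b, off_interval al (al + p.+1%:R * h) (f ^~ b)) ->
  (forall a, off_interval al (al + p.+1%:R * h) (f a)) ->
  (forall b, interp_var (f ^~ b) h p.+2 e) ->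
  (forall a, interp_var (f a) h p.+2 e) ->
  c1 <= al -> al + p.+1%:R * h <= c1 + n%:R * h ->
  c2 <= al -> al + p.+1%:R * h <= c2 + n%:R * h ->
  `|\sum_(k < n) \sum_(l < n) f (c1 + k%:R * h) (c2 + l%:R * h) -
    \sum_(k < p.+2) \sum_(l < p.+2) f (al + k%:R * h) (al + l%:R * h)|
  <= 2 * p.+2%:R * e.
Proof.
move=> h0 f1 f2 e1 e2 c1a c1b c2a c2b.
have [d1 d1i E1] := lattice_sum_window h0 c1a c1b.
have [d2 d2i E2] := lattice_sum_window h0 c2a c2b.
have -> : \sum_(k < n) \sum_(l < n) f (c1 + k%:R * h) (c2 + l%:R * h) =
    \sum_(l < p.+2) \sum_(k < p.+2) f (d1 + k%:R * h) (d2 + l%:R * h).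
  transitivity (\sum_(k < n) \sum_(l < p.+2)
      f (c1 + k%:R * h) (d2 + l%:R * h)).
    by apply: eq_bigr => k _; exact: (E2 (f _)).
  by rewrite exchange_big; apply: eq_bigr => l _; exact: (E1 (f ^~ _)).
pose mid := \sum_(l < p.+2) \sum_(k < p.+2) f (al + k%:R * h) (d2 + l%:R * h).
apply: le_trans (ler_distD mid _ _) _.
have -> : 2 * p.+2%:R * e = p.+2%:R * e + p.+2%:R * e by ring.
have S (a : R) : p.+2%:R * a = \sum_(l < p.+2) a.
  by rewrite sumr_const card_ord mulr_natl.
rewrite !S; apply: lerD.
  rewrite /mid -sumrB; apply: le_trans (ler_norm_sum _ _ _) _.
  apply: ler_sum => l _; exact: (@lattice_shift _ (f ^~ _)).
rewrite /mid exchange_big -sumrB; apply: le_trans (ler_norm_sum _ _ _) _.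
apply: ler_sum => l _; exact: (@lattice_shift _ (f _)).
Qed.

Lemma lattice_sum_bound2 {R : realType} (f : R -> R -> R) (al h C : R)
    (p n : nat) (c1 c2 : R) :
  0 < h ->
  (forall b, off_interval al (al + p.+1%:R * h) (f ^~ b)) ->
  (forall a, off_interval al (al + p.+1%:R * h) (f a)) ->
  (forall a b, f a b <= C) ->
  c1 <= al -> al + p.+1%:R * h <= c1 + n%:R * h ->
  c2 <= al -> al + p.+1%:R * h <= c2 + n%:R * h ->
  \sum_(k < n) \sum_(l < n) f (c1 + k%:R * h) (c2 + l%:R * h)
  <= p.+2%:R ^+ 2 * C.
Proof.
move=> h0 f1 f2 fC c1a c1b c2a c2b.
have [d1 d1i E1] := lattice_sum_window h0 c1a c1b.
have [d2 d2i E2] := lattice_sum_window h0 c2a c2b.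
have -> : \sum_(k < n) \sum_(l < n) f (c1 + k%:R * h) (c2 + l%:R * h) =
    \sum_(l < p.+2) \sum_(k < p.+2) f (d1 + k%:R * h) (d2 + l%:R * h).
  transitivity (\sum_(k < n) \sum_(l < p.+2)
      f (c1 + k%:R * h) (d2 + l%:R * h)).
    by apply: eq_bigr => k _; exact: (E2 (f _)).
  by rewrite exchange_big; apply: eq_bigr => l _; exact: (E1 (f ^~ _)).
have -> : p.+2%:R ^+ 2 * C = \sum_(l < p.+2) \sum_(k < p.+2) C.
  by rewrite !sumr_const !card_ord expr2 -mulrA !mulr_natl.
by apply: ler_sum => l _; apply: ler_sum => k _.
Qed.

(** * Plane vectors and rotations *)

Definition vec2 {R : realType} (a b : R) : 'cV[R]_2 := \col_i [:: a; b]`_i.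

Lemma vec2_eta {R : realType} (v : 'cV[R]_2) :
  v = vec2 (v ord0 0) (v ord_max 0).
Proof.
apply/matrixP => i j; rewrite mxE ord1.
case: (unliftP ord0 i) => [k|] -> //=; rewrite (ord1 k) /=.
by congr (v _ _); apply/val_inj.
Qed.

Lemma vec2E {R : realType} (a b : R) :
  ((vec2 a b) ord0 0 = a) * ((vec2 a b) ord_max 0 = b).
Proof. by split; rewrite mxE. Qed.

Lemma vec2D {R : realType} (a b c d : R) :
  vec2 a b + vec2 c d = vec2 (a + c) (b + d).
Proof. by rewrite [LHS]vec2_eta !mxE. Qed.

Lemma vec2N {R : realType} (a b : R) : - vec2 a b = vec2 (- a) (- b).
Proof. by rewrite [LHS]vec2_eta !mxE. Qed.

Lemma vec2Z {R : realType} (x a b : R) : x *: vec2 a b = vec2 (x * a) (x * b).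
Proof. by rewrite [LHS]vec2_eta !mxE. Qed.

Lemma enorm_vec2 {R : realType} (a b : R) :
  enorm (vec2 a b) = Num.sqrt (a ^+ 2 + b ^+ 2).
Proof. by rewrite /enorm big_ord_recl big_ord1 !mxE. Qed.

Lemma enorm_ge0 {R : realType} n (v : 'cV[R]_n) : 0 <= enorm v.
Proof. exact: sqrtr_ge0. Qed.

Lemma enorm0 {R : realType} n : enorm (0 : 'cV[R]_n) = 0.
Proof.
by rewrite /enorm big1 ?sqrtr0 // => i _; rewrite mxE expr0n.
Qed.

Lemma enormZ {R : realType} n (a : R) (v : 'cV[R]_n) :
  enorm (a *: v) = `|a| * enorm v.
Proof.
rewrite /enorm -sqrtr_sqr -sqrtrM ?sqr_ge0 // mulr_sumr.
by congr Num.sqrt; apply: eq_bigr => i _; rewrite mxE exprMn.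
Qed.

Lemma enormN {R : realType} n (v : 'cV[R]_n) : enorm (- v) = enorm v.
Proof. by rewrite -scaleN1r enormZ normrN1 mul1r. Qed.

Lemma cauchy_schwarz2 {R : realType} (a b c d : R) :
  a * c + b * d <= enorm (vec2 a b) * enorm (vec2 c d).
Proof.
rewrite !enorm_vec2 -sqrtrM ?addr_ge0 ?sqr_ge0 //.
apply: le_trans (ler_norm _) _; rewrite -sqrtr_sqr ler_sqrt.
  have : 0 <= (a * d - b * c) ^+ 2 by exact: sqr_ge0.
  by rewrite !expr2; nra.
by rewrite mulr_ge0 ?addr_ge0 ?sqr_ge0.
Qed.

Lemma enormD {R : realType} (u v : 'cV[R]_2) :
  enorm (u + v) <= enorm u + enorm v.
Proof.
rewrite [u]vec2_eta [v]vec2_eta vec2D.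
set a := u _ _; set b := u _ _; set c := v _ _; set d := v _ _.
have cs := cauchy_schwarz2 a b c d.
rewrite [X in X <= _]enorm_vec2 -[leRHS]ger0_norm ?addr_ge0 ?enorm_ge0 //.
rewrite -sqrtr_sqr ler_sqrt ?sqr_ge0 //.
have -> : (enorm (vec2 a b) + enorm (vec2 c d)) ^+ 2 = enorm (vec2 a b) ^+ 2
  + enorm (vec2 c d) ^+ 2 + 2 * (enorm (vec2 a b) * enorm (vec2 c d)) by ring.
rewrite [in leRHS]enorm_vec2 [in leRHS]enorm_vec2.
rewrite !sqr_sqrtr ?addr_ge0 ?sqr_ge0 //.
move: cs; rewrite !enorm_vec2; nra.
Qed.

Lemma enorm_dist {R : realType} (u v : 'cV[R]_2) :
  `|enorm u - enorm v| <= enorm (u - v).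
Proof.
rewrite ler_norml; apply/andP; split.
  have := enormD (v - u) u; rewrite subrK -opprB enormN; lra.
have := enormD (u - v) v; rewrite subrK; lra.
Qed.

Lemma coord_enorm {R : realType} n (v : 'cV[R]_n) i : `|v i 0| <= enorm v.
Proof.
rewrite -sqrtr_sqr ler_sqrt ?sumr_ge0 // => [|k _]; last exact: sqr_ge0.
by rewrite (bigD1 i) //= lerDl sumr_ge0 // => k _; exact: sqr_ge0.
Qed.

Lemma enorm_vec2_le {R : realType} (a b : R) :
  enorm (vec2 a b) <= `|a| + `|b|.
Proof.
rewrite enorm_vec2 -[leRHS]ger0_norm ?addr_ge0 // -sqrtr_sqr.
rewrite ler_sqrt ?sqr_ge0 // sqrrD !real_normK ?num_real //.
by rewrite lerD2r lerDl mulrn_wge0 // mulr_ge0.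
Qed.

Lemma mul_rot_vec2 {R : realType} (th a b : R) :
  rot th *m vec2 a b =
  vec2 (cos th * a - sin th * b) (sin th * a + cos th * b).
Proof.
rewrite [LHS]vec2_eta !mxE !big_ord_recl !big_ord0 !mxE /=.
by rewrite !addr0 mulNr.
Qed.

Lemma rotD {R : realType} (a b : R) : rot a *m rot b = rot (a + b).
Proof.
apply/matrixP => i j; rewrite !mxE !big_ord_recl big_ord0 !mxE /= addr0.
rewrite cosD sinD.
case: (unliftP ord0 i) => [k|] ->; rewrite ?(ord1 k) /=;
  case: (unliftP ord0 j) => [l|] ->; rewrite ?(ord1 l) /=; ring.
Qed.

Lemma rot0 {R : realType} : rot 0 = 1%:M :> 'M[R]_2.
Proof.
apply/matrixP => i j; rewrite !mxE cos0 sin0.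
case: (unliftP ord0 i) => [k|] ->; rewrite ?(ord1 k) /=;
  case: (unliftP ord0 j) => [l|] ->; rewrite ?(ord1 l) /= ?oppr0 //.
Qed.

Lemma rot_unit {R : realType} (a : R) : rot a \in unitmx.
Proof.
by have /mulmx1_unit[] : rot a *m rot (- a) = 1%:M by rewrite rotD subrr rot0.
Qed.

Lemma rotV {R : realType} (a : R) : invmx (rot a) = rot (- a).
Proof.
by rewrite -[LHS]mulmx1 -rot0 -(subrr a) -rotD mulKmx // rot_unit.
Qed.

Lemma rotKV {R : realType} (a : R) (v : 'cV[R]_2) :
  rot a *m (rot (- a) *m v) = v.
Proof. by rewrite mulmxA rotD subrr rot0 mul1mx. Qed.

Lemma enorm_rot {R : realType} (a : R) (v : 'cV[R]_2) :
  enorm (rot a *m v) = enorm v.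
Proof.
rewrite [v]vec2_eta mul_rot_vec2 !enorm_vec2; congr Num.sqrt.
set x := v _ _; set y := v _ _.
have := cos2Dsin2 a => E.
transitivity ((cos a ^+ 2 + sin a ^+ 2) * (x ^+ 2 + y ^+ 2)); first by ring.
by rewrite E mul1r.
Qed.

(** * Comparison of two rotated lattices *)

(** Weighting the double sum of psi by g(b) gives about Q1 times the total weight, and weighting it
    by g(a) gives about Q2 times it. The two weighted sums differ only through the variation of g
    over pairs with psi nonzero. *)
Lemma weighted_average {R : realType} (I : finType) (psi : I -> I -> R)
    (g : I -> R) (Q1 Q2 e : R) :
  (forall b, 0 <= g b) ->
  (forall b, 0 < g b -> `|\sum_a psi a b - Q1| <= e) ->
  (forall a, 0 < g a -> `|\sum_b psi a b - Q2| <= e) ->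
  (\sum_b g b) * `|Q1 - Q2| <=
  2 * e * (\sum_b g b) + \sum_a \sum_b `|psi a b| * `|g a - g b|.
Proof.
move=> g0 H1 H2.
pose S1 := \sum_b g b * \sum_a psi a b.
pose S2 := \sum_a g a * \sum_b psi a b.
have gx (f : I -> R) (Q : R) : (forall b, 0 < g b -> `|f b - Q| <= e) ->
    `|\sum_b g b * f b - (\sum_b g b) * Q| <= e * \sum_b g b.
  move=> fQ; rewrite mulr_suml mulr_sumr -sumrB.
  apply: le_trans (ler_norm_sum _ _ _) _; apply: ler_sum => b _.
  rewrite -mulrBr normrM (ger0_norm (g0 b)) mulrC.
  have := g0 b; rewrite le_eqVlt => /orP[/eqP <-|gb]; first by rewrite !mulr0.
  by rewrite ler_pM2r // fQ.
have D1 := gx _ _ H1; have D2 := gx _ _ H2.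
have D3 : `|S1 - S2| <= \sum_a \sum_b `|psi a b| * `|g a - g b|.
  have -> : S1 - S2 = \sum_a \sum_b psi a b * (g b - g a).
    rewrite /S1; under eq_bigr do rewrite mulr_sumr.
    rewrite exchange_big /= -sumrB; apply: eq_bigr => a _.
    by rewrite mulr_sumr -sumrB; apply: eq_bigr => b _; ring.
  apply: le_trans (ler_norm_sum _ _ _) _; apply: ler_sum => a _.
  apply: le_trans (ler_norm_sum _ _ _) _; apply: ler_sum => b _.
  by rewrite normrM distrC.
rewrite -[X in X * _]ger0_norm ?sumr_ge0 // -normrM mulrBr.
set G := \sum_b g b in D1 D2 *.
have -> : G * Q1 - G * Q2 = - (S1 - G * Q1) + (S1 - S2) + (S2 - G * Q2) by ring.
apply: le_trans (ler_normD _ _) _.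
have := ler_normD (- (S1 - G * Q1)) (S1 - S2); rewrite normrN.
move: D1 D2 D3; rewrite -/S1 -/S2; lra.
Qed.

(** The indices from 3m to 5m - 1 lie within m of the centre 4m of a range of 8m + 1 nodes. This
    serves to bound the total radial weight from below. *)
Lemma sum_lower_block {R : realType} (F : nat -> R) (x : R) (m : nat) :
  (forall i, 0 <= F i) ->
  (forall i, (3 * m <= i < 5 * m)%N -> x <= F i) ->
  (2 * m)%:R * x <= \sum_(i < (8 * m).+1) F i.
Proof.
move=> F0 Fx; rewrite -(big_mkord xpredT F).
rewrite (@big_cat_nat _ _ _ (3 * m)) /=; [|lia|lia].
rewrite (@big_cat_nat _ _ _ (5 * m) (3 * m)) /=; [|lia|lia].
have -> : (2 * m)%:R * x = \sum_(3 * m <= i < 5 * m) x.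
  by rewrite sumr_const_nat mulr_natl; congr (_ *+ _); lia.
have A1 : 0 <= \sum_(0 <= i < 3 * m) F i by exact: sumr_ge0.
have A2 : 0 <= \sum_(5 * m <= i < (8 * m).+1) F i by exact: sumr_ge0.
have A3 : \sum_(3 * m <= i < 5 * m) x <= \sum_(3 * m <= i < 5 * m) F i.
  by rewrite big_nat_cond [leRHS]big_nat_cond ler_sum // => i /andP[/Fx].
lra.
Qed.

(* Two lattices of the same shape, one rotated: pairing them through
   psi (a + K b) with a radial weight averages each sum over shifts by points
   of the other lattice. *)
Lemma lattice_rotation {R : realType} (psi : 'cV[R]_2 -> R)
    (h e C kappa : R) (p : nat) :
  0 < h ->
  (forall y, p.+1%:R * h / 2 <= enorm y -> psi y = 0) ->
  (forall y, `|psi y| <= C) ->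
  (forall q w, enorm w = 1 ->
    interp_var (fun x => psi (q + x *: w)) h p.+2 e) ->
  let al := - (p.+1%:R * h / 2) in
  `|\sum_(k < p.+2) \sum_(l < p.+2)
      psi (rot kappa *m vec2 (al + k%:R * h) (al + l%:R * h)) -
    \sum_(k < p.+2) \sum_(l < p.+2) psi (vec2 (al + k%:R * h) (al + l%:R * h))|
  <= 4 * p.+2%:R * e.
Proof.
move=> h0 supp psiC psie; cbv zeta.
set rho := p.+1%:R * h / 2 in supp *; set al := - rho.
have rho0 : 0 <= rho by rewrite /rho divr_ge0 // mulr_ge0 // ltW.
have alE : al + p.+1%:R * h = rho.
  by rewrite /al /rho; lra.
clearbody rho.
have C0 : 0 <= C := le_trans (normr_ge0 _) (psiC 0).
have uA : enorm (vec2 1 0 : 'cV[R]_2) = 1.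
  by rewrite enorm_vec2 expr1n expr0n addr0 sqrtr1.
have uB : enorm (vec2 0 1 : 'cV[R]_2) = 1.
  by rewrite enorm_vec2 expr1n expr0n add0r sqrtr1.
pose f th (a b : R) := psi (rot th *m vec2 a b).
have absrho (x : R) : x <= al \/ al + p.+1%:R * h <= x -> rho <= `|x|.
  by rewrite alE /al lerNr -normrN => -[|] /le_trans -> //;
     rewrite ?ler_norm // normrN ler_norm.
have f1 th b : off_interval al (al + p.+1%:R * h) (f th ^~ b).
  move=> x /absrho xr; apply: supp; rewrite enorm_rot.
  by apply: le_trans xr _; have := coord_enorm (vec2 x b) ord0; rewrite mxE.
have f2 th a : off_interval al (al + p.+1%:R * h) (f th a).
  move=> x /absrho xr; apply: supp; rewrite enorm_rot.
  by apply: le_trans xr _; have := coord_enorm (vec2 a x) ord_max; rewrite mxE.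
have e1 th b : interp_var (f th ^~ b) h p.+2 e.
  have := psie (rot th *m vec2 0 b) (rot th *m vec2 1 0).
  rewrite enorm_rot => /(_ uA); congr interp_var; apply: funext => x.
  by rewrite /f scalemxAr -mulmxDr vec2Z vec2D mulr1 mulr0 add0r addr0.
have e2 th a : interp_var (f th a) h p.+2 e.
  have := psie (rot th *m vec2 a 0) (rot th *m vec2 0 1).
  rewrite enorm_rot => /(_ uB); congr interp_var; apply: funext => x.
  by rewrite /f scalemxAr -mulmxDr vec2Z vec2D mulr1 mulr0 add0r addr0.
pose Q th : R := \sum_(k < p.+2) \sum_(l < p.+2)
  f th (al + k%:R * h) (al + l%:R * h).
have -> : \sum_(k < p.+2) \sum_(l < p.+2)
    psi (vec2 (al + k%:R * h) (al + l%:R * h)) = Q 0.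
  by apply: eq_bigr => k _; apply: eq_bigr => l _; rewrite /f rot0 mul1mx.
rewrite -[X in `|X - _|]/(Q kappa).
(* The total weight is at least 4 m^3 h, while the variation of the weight contributes only O(m^2).
   Letting m grow removes this second term. *)
suff main m : rho <= m%:R * h ->
    4 * m%:R ^+ 3 * h * `|Q kappa - Q 0| <=
    4 * m%:R ^+ 3 * h * (4 * p.+2%:R * e) +
    162 * rho * m%:R ^+ 2 * p.+2%:R ^+ 2 * C.
  rewrite leNgt; apply/negP => lt.
  pose D : R := `|Q kappa - Q 0| - 4 * p.+2%:R * e.
  have D0 : 0 < D by rewrite subr_gt0.
  pose T : R := 162 * rho * p.+2%:R ^+ 2 * C.
  have T0 : 0 <= T.
    by rewrite /T !mulr_ge0 ?sqr_ge0.
  (* The first summand makes the cubic term beat the quadratic one for m = M + 1, and the second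
     ensures rho <= m h. *)
  pose M := Num.truncn (T / (4 * h * D) + rho / h).
  have : T / (4 * h * D) + rho / h < M.+1%:R by exact: truncnS_gt.
  have t1 : 0 <= T / (4 * h * D) by rewrite divr_ge0 // !mulr_ge0 // ltW.
  have t2 : 0 <= rho / h by rewrite divr_ge0 // ltW.
  move=> lM.
  have M1 : T < M.+1%:R * (4 * h * D) by rewrite -ltr_pdivrMr ?mulr_gt0 //; lra.
  have M2 : rho <= M.+1%:R * h by rewrite -ler_pdivrMr //; lra.
  have := main _ M2.
  have : 0 < M.+1%:R ^+ 2 * (M.+1%:R * (4 * h * D) - T).
    by rewrite mulr_gt0 ?exprn_gt0 // subr_gt0.
  rewrite /T /D; set x := `|_|; set n := M.+1%:R.
  move=> h1 h2; suff: (0 : R) < 0 by rewrite ltxx.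
  apply: lt_le_trans h1 _; move: h2; rewrite -subr_ge0 => h2.
  by rewrite -oppr_ge0; apply: le_trans h2 _; rewrite le_eqVlt; apply/orP; left;
     apply/eqP; ring.
move=> mrho.
(* Large centred lattice of half-width 4mh. A shift of length at most [Rad] still leaves the support
   of psi covered. The weight g is a cone of radius [Rad], hence 1-Lipschitz. *)
pose n := (8 * m).+1; pose c : R := - (4 * m%:R * h).
pose P (i : 'I_n * 'I_n) : 'cV[R]_2 :=
  vec2 (c + i.1%:R * h) (c + i.2%:R * h).
pose Rad := 4 * m%:R * h - rho.
pose g (v : 'cV[R]_2) : R := Num.max 0 (Rad - enorm v).
have g0 v : 0 <= g v by rewrite /g le_max lexx.
have gpos v : 0 < g v -> enorm v <= Rad.
  by rewrite /g lt_max ltxx /= subr_gt0 => /ltW.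
have nE : n%:R = 8 * m%:R + 1 :> R by rewrite /n -natr1 natrM.
have cov (s : R) : `|s| <= Rad -> c + s <= al /\
    al + p.+1%:R * h <= (c + s) + n%:R * h.
  rewrite alE nE mulrDl mul1r ler_norml /c /al /Rad => /andP[s1 s2].
  by split; lra.
have sumP (F : 'cV[R]_2 -> R) : \sum_i F (P i) =
    \sum_(k < n) \sum_(l < n) F (vec2 (c + k%:R * h) (c + l%:R * h)).
  by rewrite pair_bigA.
have win (s : 'cV[R]_2) : enorm s <= Rad -> [/\ c + s ord0 0 <= al,
    al + p.+1%:R * h <= (c + s ord0 0) + n%:R * h,
    c + s ord_max 0 <= al &
    al + p.+1%:R * h <= (c + s ord_max 0) + n%:R * h].
  move=> sR; have [] := cov _ (le_trans (coord_enorm s ord0) sR).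
  by have [] := cov _ (le_trans (coord_enorm s ord_max) sR).
have PsE (s : 'cV[R]_2) k l : vec2 (c + k * h) (c + l * h) + s =
    vec2 (c + s ord0 0 + k * h) (c + s ord_max 0 + l * h).
  by rewrite [s in LHS]vec2_eta vec2D; congr vec2; ring.
have shift th s : enorm s <= Rad ->
    `|\sum_i psi (rot th *m (P i + s)) - Q th| <= 2 * p.+2%:R * e.
  move=> /win[w1 w2 w3 w4].
  rewrite (sumP (fun v => psi (rot th *m (v + s)))).
  under eq_bigr do under eq_bigr do rewrite PsE.
  exact: (lattice_shift2 (f := f th)).
have bnd th s : enorm s <= Rad ->
    \sum_i `|psi (rot th *m (P i + s))| <= p.+2%:R ^+ 2 * C.
  move=> /win[w1 w2 w3 w4].
  rewrite (sumP (fun v => `|psi (rot th *m (v + s))|)).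
  under eq_bigr do under eq_bigr do rewrite PsE.
  apply: (lattice_sum_bound2 (f := fun a b => `|f th a b|) (al := al)) => //.
  - by move=> b x xx; rewrite f1 ?normr0.
  - by move=> a x xx; rewrite f2 ?normr0.
  - by move=> a b; exact: psiC.
pose Psi i j := psi (P i + rot kappa *m P j).
have PsiE i j : Psi i j = psi (rot kappa *m (P j + rot (- kappa) *m P i)).
  by rewrite /Psi mulmxDr rotKV addrC.
(* For fixed j the points P i + K P j form a shift of the unrotated lattice. For fixed i they form a
   shift of the rotated one, by [PsiE]. *)
have H1 j : 0 < g (P j) -> `|\sum_i Psi i j - Q 0| <= 2 * p.+2%:R * e.
  move=> /gpos gj; under eq_bigr do rewrite /Psi -[_ + _]mul1mx -rot0.
  by apply: shift; rewrite enorm_rot.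
have H2 i : 0 < g (P i) -> `|\sum_j Psi i j - Q kappa| <= 2 * p.+2%:R * e.
  move=> /gpos gj; under eq_bigr do rewrite PsiE.
  by apply: shift; rewrite enorm_rot.
have := weighted_average (fun i => g0 (P i)) H1 H2.
rewrite distrC; set G := \sum_i g (P i); set E := \sum_i \sum_j _ => avg.
have B1 i : 0 < g (P i) -> \sum_j `|Psi i j| <= p.+2%:R ^+ 2 * C.
  move=> /gpos gj; under eq_bigr do rewrite PsiE.
  by apply: bnd; rewrite enorm_rot.
have B2 j : 0 < g (P j) -> \sum_i `|Psi i j| <= p.+2%:R ^+ 2 * C.
  move=> /gpos gj; under eq_bigr do rewrite /Psi -[_ + _]mul1mx -rot0.
  by apply: bnd; rewrite enorm_rot.
(* If psi (P i + K P j) is nonzero, the norms of P i and P j differ by less than rho, hence so do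
   the weights by at most rho. Each such pair is charged to an index of positive weight, whose row
   or column sum is bounded by [B1] or [B2]. *)
have EC : E <= 2 * rho * (n%:R ^+ 2 * (p.+2%:R ^+ 2 * C)).
  have term i j : `|Psi i j| * `|g (P i) - g (P j)| <=
      rho * (`|Psi i j| * (0 < g (P i))%R%:R) + rho * (`|Psi i j| * (0 < g (P j))%R%:R).
    have [near|far] := ltP (enorm (P i + rot kappa *m P j)) rho; last first.
      by rewrite /Psi supp // normr0 !mul0r mulr0 addr0.
    have dist : `|enorm (P i) - enorm (P j)| <= rho.
      rewrite -(enorm_rot kappa (P j)) -(enormN (rot kappa *m P j)).
      by apply: le_trans (enorm_dist _ _) _; rewrite opprK ltW.
    have dg : `|g (P i) - g (P j)| <= rho.
      move: dist; rewrite /g !ler_norml => /andP[d1 d2].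
      by case: (leP 0 (Rad - enorm (P i))) => ?;
         case: (leP 0 (Rad - enorm (P j))) => ?; apply/andP; split; lra.
    have := g0 (P i); rewrite le_eqVlt => /orP[/eqP gi|gi].
      have := g0 (P j); rewrite le_eqVlt => /orP[/eqP gj|gj].
        by rewrite -gi -gj subrr normr0 ltxx !mulr0 addr0.
      rewrite gj -{2}gi ltxx !mulr0 add0r mulr1 mulrC.
      by rewrite ler_wpM2r.
    rewrite gi mulr1; apply: le_trans (_ : rho * `|Psi i j| <= _).
      by rewrite mulrC ler_wpM2r.
    by rewrite lerDl !mulr_ge0.
  have cardP : (#|{: 'I_n * 'I_n}|)%:R = n%:R ^+ 2 :> R.
    by rewrite card_prod card_ord natrM expr2.
  have half (F : 'I_n * 'I_n -> R) : (forall i, F i <= p.+2%:R ^+ 2 * C) ->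
      \sum_i rho * F i <= rho * (n%:R ^+ 2 * (p.+2%:R ^+ 2 * C)).
    move=> FC; rewrite -mulr_sumr ler_wpM2l //.
    apply: le_trans (ler_sum _ (fun i _ => FC i)) _.
    by rewrite -cardP mulr_natl sumr_const.
  apply: le_trans (ler_sum _ (fun i _ => ler_sum _ (fun j _ => term i j))) _.
  under eq_bigr do rewrite big_split; rewrite big_split /=.
  have -> : 2 * rho * (n%:R ^+ 2 * (p.+2%:R ^+ 2 * C)) =
    rho * (n%:R ^+ 2 * (p.+2%:R ^+ 2 * C)) +
    rho * (n%:R ^+ 2 * (p.+2%:R ^+ 2 * C)) by ring.
  apply: lerD.
    under eq_bigr do rewrite -mulr_sumr -mulr_suml.
    apply: half => i; case: (boolP (0 < g (P i))) => [gi|_].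
      by rewrite mulr1 B1.
    by rewrite mulr0 mulr_ge0 ?sqr_ge0.
  rewrite exchange_big /=.
  under eq_bigr do rewrite -mulr_sumr -mulr_suml.
  apply: half => i; case: (boolP (0 < g (P i))) => [gi|_].
    by rewrite mulr1 B2.
  by rewrite mulr0 mulr_ge0 ?sqr_ge0.
(* On the (2m)^2 central nodes the norm is at most 2mh, so that the weight is at least 2mh - rho >=
   mh. *)
have G4 : 4 * m%:R ^+ 3 * h <= G.
  rewrite /G (sumP g).
  have -> : 4 * m%:R ^+ 3 * h =
      (2 * m)%:R * ((2 * m)%:R * (m%:R * h)) :> R by rewrite natrM; ring.
  apply: (sum_lower_block (F := fun k : nat => \sum_(l < n)
      g (vec2 (c + k%:R * h) (c + l%:R * h)))) => [k|k Hk].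
    exact: sumr_ge0.
  apply: (sum_lower_block (F := fun l : nat =>
      g (vec2 (c + k%:R * h) (c + l%:R * h)))) => [//|l Hl].
  have coord (i : nat) : (3 * m <= i < 5 * m)%N -> `|c + i%:R * h| <= m%:R * h.
    move=> /andP[i1 i2]; rewrite /c ler_norml.
    have : (3 * m)%:R * h <= i%:R * h by rewrite ler_pM2r // ler_nat.
    have : i%:R * h <= (5 * m)%:R * h by rewrite ler_pM2r // ler_nat ltnW.
    by rewrite !natrM => ? ?; apply/andP; split; lra.
  rewrite /g le_max; apply/orP; right.
  have := enorm_vec2_le (c + k%:R * h) (c + l%:R * h).
  have := coord _ Hk; have := coord _ Hl.
  by rewrite /Rad; lra.
have [m0|m0] := posnP m.
  by rewrite m0 !expr0n /= !(mulr0, mul0r) addr0.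
pose D : R := `|Q kappa - Q 0| - 4 * p.+2%:R * e.
have [Dle|Dgt] := leP D 0.
  have : 4 * m%:R ^+ 3 * h * D <= 0.
    by rewrite mulr_ge0_le0 // !mulr_ge0 ?exprn_ge0 // ltW.
  have : 0 <= 162 * rho * m%:R ^+ 2 * p.+2%:R ^+ 2 * C.
    by rewrite !mulr_ge0 ?sqr_ge0.
  by rewrite /D mulrBr; lra.
have GD : 4 * m%:R ^+ 3 * h * D <= G * D by rewrite ler_pM2r.
have GE : G * D <= E by move: avg; rewrite /D; lra.
have nm : n%:R ^+ 2 <= 81 * m%:R ^+ 2 :> R.
  have -> : 81 * m%:R ^+ 2 = (9 * m)%:R ^+ 2 :> R by rewrite natrM exprMn; ring.
  by rewrite ler_pXn2r ?nnegrE ?ler0n // ler_nat /n; lia.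
have : 2 * rho * (n%:R ^+ 2 * (p.+2%:R ^+ 2 * C)) <=
    2 * rho * (81 * m%:R ^+ 2 * (p.+2%:R ^+ 2 * C)).
  rewrite ler_wpM2l ?mulr_ge0 // ler_wpM2r // mulr_ge0 ?sqr_ge0 //.
have -> : 2 * rho * (81 * m%:R ^+ 2 * (p.+2%:R ^+ 2 * C)) =
  162 * rho * m%:R ^+ 2 * p.+2%:R ^+ 2 * C by ring.
move: GD; rewrite /D mulrBr => GD.
by move: GE EC; rewrite /D; lra.
Qed.

(** * Variation of slopes *)

(** Slope on the interval from node k - 1 to node k. The shift by one leaves index 0 for the zero
    slope on the left, and index n + 1 carries the one on the right. *)
Definition eslope {R : realType} (f : R -> R) (x : nat -> R) (n k : nat) : R :=
  if k is k'.+1 then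
    if (k' < n)%N then (f (x k'.+1) - f (x k')) / (x k'.+1 - x k') else 0
  else 0.

(* Total variation of the slopes of the piecewise linear interpolant of f at
   the nodes x 0, ..., x n, extended by constants on both sides. *)
Definition slope_var {R : realType} (f : R -> R) (x : nat -> R) (n : nat) : R :=
  \sum_(k < n.+1) `|eslope f x n k.+1 - eslope f x n k|.

Definition increasing_nodes {R : realType} (x : nat -> R) (n : nat) : Prop :=
  forall k, (k < n)%N -> x k < x k.+1.

Definition neg_part {R : realType} (x : R) : R := Num.max 0 (- x).

(** The jumps of the slope telescope to 0, as the slope is 0 at both ends, and |d| = d + 2
    [neg_part] d. *)
Lemma slope_varE {R : realType} (f : R -> R) (x : nat -> R) (n : nat) :
  slope_var f x n =
  2 * \sum_(k < n.+1) neg_part (eslope f x n k.+1 - eslope f x n k).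
Proof.
have tel : \sum_(k < n.+1) (eslope f x n k.+1 - eslope f x n k) = 0.
  rewrite -(big_mkord xpredT
    (fun k : nat => eslope f x n k.+1 - eslope f x n k)).
  by rewrite telescope_sumr //= ltnn subr0.
rewrite /slope_var -[RHS]addr0 -[X in _ = _ + X]tel mulr_sumr -big_split /=.
apply: eq_bigr => k _; set d := _ - _; rewrite /neg_part.
by case: (leP 0 d) => d0; case: (leP 0 (- d)) => d1;
  rewrite ?(ger0_norm d0) ?(ltr0_norm d0); lra.
Qed.

(* relu is convex, nondecreasing and 1-Lipschitz, so that it shrinks the
   negative part of each second difference; their sum vanishes, so that the
   negative part controls the whole variation. *)
Lemma slope_var_relu {R : realType} (f : R -> R) (x : nat -> R) (n : nat) :
  increasing_nodes x n -> slope_var (fun y => relu (f y)) x n <= slope_var f x n.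
Proof.
move=> xlt; rewrite !slope_varE ler_pM2l //; apply: ler_sum => k _.
have neg_le (u v : R) : 0 <= u \/ v <= u -> neg_part u <= neg_part v.
  by rewrite /neg_part ge_max !le_max lexx /= lerN2 oppr_le0 => -[->|->];
     rewrite ?orbT.
have relu_diff (a b : R) : a <= b -> 0 <= relu b - relu a <= b - a.
  rewrite /relu => ab.
  by case: (leP a 0) => a0; case: (leP b 0) => b0; apply/andP; split; lra.
(* The three cases of a slope jump: [mono] at the first node, [lip] at the last one, [conv] at an
   interior one. *)
have mono (a b i : R) : 0 < i ->
    neg_part ((relu b - relu a) * i) <= neg_part ((b - a) * i).
  move=> i0; apply: neg_le; case: (leP a b) => ab.
    by left; rewrite mulr_ge0 ?(ltW i0) //; case/andP: (relu_diff _ _ ab).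
  right; rewrite ler_pM2r //.
  by have /andP[] := relu_diff _ _ (ltW ab); lra.
have lip (a b i : R) : 0 < i ->
    neg_part (0 - (relu b - relu a) * i) <= neg_part (0 - (b - a) * i).
  move=> i0; rewrite !sub0r -!mulNr; apply: neg_le; case: (leP b a) => ab.
    left; rewrite mulr_ge0 ?(ltW i0) //.
    by have /andP[] := relu_diff _ _ ab; lra.
  right; rewrite ler_pM2r // lerN2.
  by case/andP: (relu_diff _ _ (ltW ab)).
(* If b <= 0, relu vanishes at b and the new second difference is nonnegative. If b > 0, relu keeps
   b and can only raise a and c, which increases the second difference. *)
have conv (a b c i j : R) : 0 < i -> 0 < j ->
    neg_part ((relu c - relu b) * j - (relu b - relu a) * i) <=
    neg_part ((c - b) * j - (b - a) * i).
  move=> i0 j0; apply: neg_le.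
  have ca : a <= relu a by rewrite le_max lexx.
  have cc : c <= relu c by rewrite le_max lexx.
  have za : 0 <= relu a by rewrite le_max lexx orbT.
  have zc : 0 <= relu c by rewrite le_max lexx orbT.
  case: (leP b 0) => b0.
    left; rewrite [relu b]max_r // subr0 sub0r mulNr opprK.
    by rewrite addr_ge0 // mulr_ge0 // ltW.
  right; rewrite [relu b]max_l ?(ltW b0) //.
  by rewrite lerB // ler_pM2r // ?lerB // lerD2l lerN2.
have pos (i : nat) : (i < n)%N -> 0 < (x i.+1 - x i)^-1.
  by move=> i_n; rewrite invr_gt0 subr_gt0 xlt.
case: k => [[|k] kn] /=.
  case: ifP => [n0|_]; last by rewrite subrr.
  by rewrite !subr0 mono // pos.
have k0 : (k < n)%N by [].
rewrite k0; case: ifP => k1; last exact: lip (pos _ k0).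
exact: conv (pos _ k0) (pos _ k1).
Qed.

Lemma slope_varZ {R : realType} (a : R) (f : R -> R) (x : nat -> R) (n : nat) :
  slope_var (fun y => a * f y) x n = `|a| * slope_var f x n.
Proof.
have eslopeZ k : eslope (fun y => a * f y) x n k = a * eslope f x n k.
  case: k => [|k] /=; first by rewrite mulr0.
  by case: ifP => _; rewrite ?mulr0 // -mulrBr mulrA.
by rewrite mulr_sumr; apply: eq_bigr => k _; rewrite !eslopeZ -mulrBr normrM.
Qed.

Lemma slope_var_sum {R : realType} (I : Type) (s : seq I)
    (f : I -> R -> R) (x : nat -> R) (n : nat) :
  slope_var (fun y => \sum_(i <- s) f i y) x n <=
  \sum_(i <- s) slope_var (f i) x n.
Proof.
have eslope_sum k : eslope (fun y => \sum_(i <- s) f i y) x n k =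
    \sum_(i <- s) eslope (f i) x n k.
  case: k => [|k] /=; first by rewrite big1.
  by case: ifP => _; [rewrite -sumrB mulr_suml | rewrite big1].
rewrite /slope_var exchange_big; apply: ler_sum => k _.
rewrite !eslope_sum -sumrB; exact: ler_norm_sum.
Qed.

(** Integrated form of |f''| <= H, with equality for f(x) = H x^2 / 2. *)
Definition second_diff_le {R : realType} (f : R -> R) (H : R) : Prop :=
  forall a b c, a < b -> b < c ->
  `|(f c - f b) / (c - b) - (f b - f a) / (b - a)| <= H * (c - a) / 2.

(** The two outer jumps are slopes, each at most G. In the sum of the interior jumps every interval
    is counted at most twice, each time with factor H / 2. *)
Lemma slope_var_second_diff {R : realType} (f : R -> R) (G H : R)
    (x : nat -> R) (n : nat) :
  0 <= G -> 0 <= H ->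
  (forall a b, `|f a - f b| <= G * `|a - b|) -> second_diff_le f H ->
  increasing_nodes x n ->
  slope_var f x n <= H * (x n - x 0%N) + 2 * G.
Proof.
move=> G0 H0 fG fH xlt; rewrite /slope_var.
have sl k : (k < n)%N -> `|(f (x k.+1) - f (x k)) / (x k.+1 - x k)| <= G.
  move=> /xlt kx; rewrite normrM normfV ler_pdivrMr ?fG // normr_gt0.
  by rewrite subr_eq0 gt_eqF.
case: n xlt sl => [|n] xlt sl.
  by rewrite big_ord1 /= subrr normr0 subrr mulr0 add0r mulr_ge0.
rewrite big_ord_recl big_ord_recr /= !ltnS leqnn ltnn subr0 sub0r normrN.
have -> : H * (x n.+1 - x 0%N) + 2 * G =
  G + (H * (x n.+1 - x 0%N) + G) by ring.
apply: lerD; first exact: sl.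
apply: lerD; last exact: sl.
apply: le_trans (_ : \sum_(k < n) H * (x k.+2 - x k) / 2 <= _).
  apply: ler_sum => k _; rewrite /bump /= !add1n !add0n ltnS ltn_ord.
  rewrite (ltn_trans (ltn_ord k) (ltnSn n)).
  by apply: fH; apply: xlt; rewrite ltnS // ltnW.
(* Adding and subtracting x (k + 1) makes the sum telescope. *)
have -> : \sum_(k < n) H * (x k.+2 - x k) / 2 =
    H / 2 * \sum_(k < n) ((x k.+2 + x k.+1) - (x k.+1 + x k)).
  by rewrite mulr_sumr; apply: eq_bigr => k _; ring.
rewrite -(big_mkord xpredT (fun k => x k.+2 + x k.+1 - (x k.+1 + x k))).
rewrite (telescope_sumr (fun k => x k.+1 + x k)) //.
have h1 : x 0%N < x 1%N by exact: xlt.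
have h2 : x n < x n.+1 by exact: xlt.
have : 0 <= H * ((x n.+1 - x n) + (x 1%N - x 0%N)).
  by rewrite mulr_ge0 // addr_ge0 // subr_ge0 ltW.
by nra.
Qed.

(** This discards the slope jumps at auxiliary nodes and keeps those at lattice points, which get
    odd indices. *)
Lemma sum_odd_le {R : realType} (a : nat -> R) (m : nat) :
  (forall k, 0 <= a k) ->
  \sum_(k < m) a (k.*2.+1) <= \sum_(k < m.*2.+1) a k.
Proof.
move=> a0; elim: m => [|m IH]; first by rewrite big_ord0 sumr_ge0.
rewrite big_ord_recr doubleS !big_ord_recr /=.
rewrite big_ord_recr /= in IH.
by have := a0 m.*2.+2; have := a0 m.*2; lra.
Qed.

(** An interpolation defect is a slope jump times at most h / 4, and slope jumps obey a discrete
    product rule. The term [2 * G0] in the slope variation of v carries no factor h. It meets |f| <=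
    G rho, which supplies one and yields one of the two G G0; the product rule yields the other. *)
Lemma interp_var_mul {R : realType} (f v : R -> R) (h rho : R) (p : nat)
    (F G H F0 G0 H0 : R) :
  0 < h -> rho <= p.+2%:R * h / 2 ->
  (forall x, `|f x| <= F) -> (forall x, `|f x| <= G * rho) ->
  0 <= G -> 0 <= H -> 0 <= G0 -> 0 <= H0 ->
  (forall a b, `|f a - f b| <= G * `|a - b|) -> second_diff_le f H ->
  (forall x, `|v x| <= F0) ->
  (forall a b, `|v a - v b| <= G0 * `|a - b|) ->
  (forall x n, increasing_nodes x n ->
    slope_var v x n <= H0 * (x n - x 0%N) + 2 * G0) ->
  interp_var (fun x => f x * v x) h p.+2
    (p.+2%:R * h ^+ 2 / 4 * (F0 * H / 2 + 2 * G * G0 + F * H0)).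
Proof.
move=> h0 rhole fF fGr G_0 H_0 G0_0 H0_0 fG fH vF vG vS y la la0 la1.
have F_0 : 0 <= F := le_trans (normr_ge0 _) (fF 0).
have F0_0 : 0 <= F0 := le_trans (normr_ge0 _) (vF 0).
set e := (X in _ <= X).
have e0 : 0 <= e.
  rewrite /e mulr_ge0 ?divr_ge0 ?mulr_ge0 ?exprn_ge0 ?(ltW h0) //.
  by rewrite !addr_ge0 ?divr_ge0 ?mulr_ge0.
(* At [la] = 0 or 1 the defect is 0. Excluding these values makes both s and s' positive, as the
   divisions below require. *)
move: la0; rewrite le_eqVlt => /orP[/eqP la0|la0].
  rewrite big1 // => k _; rewrite /interp_defect -la0.
  by rewrite mul0r !subr0 mul1r mul0r addr0 subrr normr0.
move: la1; rewrite le_eqVlt => /orP[/eqP la1|la1].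
  rewrite big1 // => k _; rewrite /interp_defect la1.
  by rewrite subrr !mul0r mul1r addr0 add0r subrr normr0.
pose s := la * h; pose s' := (1 - la) * h.
have s0 : 0 < s by rewrite mulr_gt0.
have s'0 : 0 < s' by rewrite mulr_gt0 // subr_gt0.
have ss' : s + s' = h by rewrite /s /s'; ring.
(* Odd nodes are the lattice points z = y + kh. Even nodes are the points z - s, and z + s' is the
   next even node. *)
pose x (j : nat) : R := y + j./2%:R * h - (if odd j then 0 else s).
have x_even k : x k.*2 = y + k%:R * h - s by rewrite /x doubleK odd_double.
have x_odd k : x k.*2.+1 = y + k%:R * h.
  by rewrite /x /= uphalf_double odd_double subr0.
have x_next k : x k.*2.+2 = y + k%:R * h + s'.
  by rewrite -doubleS x_even -natr1 -ss'; ring.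
have xlt n : increasing_nodes x n.
  move=> k _; rewrite -(odd_double_half k); case: (odd k) => /=.
    by rewrite add1n x_odd x_next; lra.
  by rewrite add0n x_even x_odd; lra.
pose d (u : R -> R) (k : nat) : R := let z := y + k%:R * h in
  (u (z + s') - u z) / s' - (u z - u (z - s)) / s.
(* The defect is a multiple of the slope jump d at the lattice point, and the factor is at most h /
   4 in absolute value because [la] (1 - [la]) <= 1 / 4. *)
have defE (u : R -> R) k : interp_defect u h la (y + k%:R * h) =
    - (la * (1 - la) * h) * d u k.
  rewrite /interp_defect /d -/s -/s'; set z := y + _.
  have -> : (1 - la) = s' / h by rewrite /s' mulfK // gt_eqF.
  have -> : la = s / h by rewrite /s mulfK // gt_eqF.
  have hE : h = s + s' by rewrite ss'.
  rewrite hE; field.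
  by rewrite !gt_eqF // ?addr_gt0.
have la4 : la * (1 - la) * h <= h / 4.
  have : 0 <= (1 - 2 * la) ^+ 2 by exact: sqr_ge0.
  rewrite expr2; nra.
have lah : 0 <= la * (1 - la) * h.
  by rewrite !mulr_ge0 // ?ltW // subr_gt0.
have dv_sum : \sum_(k < p.+2) `|d v k| <= H0 * (p.+2%:R * h) + 2 * G0.
  have := vS x p.+2.*2 (xlt _).
  have -> : x p.+2.*2 - x 0%N = p.+2%:R * h.
    by rewrite x_even -[0%N]/(0.*2) x_even; ring.
  apply: le_trans.
  pose a k := `|eslope v x p.+2.*2 k.+1 - eslope v x p.+2.*2 k|.
  apply: le_trans (_ : \sum_(k < p.+2) a k.*2.+1 <= _); last first.
    by apply: (sum_odd_le (a := a)) => k; exact: normr_ge0.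
  apply: ler_sum => k _; rewrite /a /eslope.
  have kp : (k.*2.+1 < p.+2.*2)%N by rewrite ltn_Sdouble.
  rewrite kp (ltnW kp) x_next x_odd x_even /d.
  set z := y + _.
  have -> : z + s' - z = s' by ring.
  by have -> : z - (z - s) = s by ring.
have d_mul k : `|d (fun x => f x * v x) k| <=
    `|f (y + k%:R * h)| * `|d v k|
    + (F0 * (H * h / 2) + G * G0 * h).
  set z := y + _.
  pose sR := (f (z + s') - f z) / s'; pose sL := (f z - f (z - s)) / s.
  (* Discrete product rule: two second-difference terms, and the products of the first differences
     on either side of z. *)
  have -> : d (fun x => f x * v x) k = f z * d v k + (v z * d f k +
      (sR * (v (z + s') - v z) + sL * (v z - v (z - s)))).
    by rewrite /d /sR /sL -/z; ring.
  have sRG : `|sR| <= G.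
    rewrite /sR normrM normfV ler_pdivrMr ?normr_gt0 ?gt_eqF //.
    by have := fG (z + s') z; have -> : z + s' - z = s' by ring.
  have sLG : `|sL| <= G.
    rewrite /sL normrM normfV ler_pdivrMr ?normr_gt0 ?gt_eqF //.
    by have := fG z (z - s); have -> : z - (z - s) = s by ring.
  have dfH : `|d f k| <= H * h / 2.
    have := fH (z - s) z (z + s').
    have -> : z + s' - z = s' by ring.
    have -> : z - (z - s) = s by ring.
    have -> : z + s' - (z - s) = h by rewrite -ss'; ring.
    by apply; lra.
  have vR : `|v (z + s') - v z| <= G0 * s'.
    have := vG (z + s') z; have -> : z + s' - z = s' by ring.
    by rewrite (gtr0_norm s'0).
  have vL : `|v z - v (z - s)| <= G0 * s.
    have := vG z (z - s); have -> : z - (z - s) = s by ring.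
    by rewrite (gtr0_norm s0).
  apply: le_trans (ler_normD _ _) _; rewrite normrM; apply: lerD => //.
  apply: le_trans (ler_normD _ _) _; rewrite normrM; apply: lerD.
    exact: ler_pM.
  apply: le_trans (ler_normD _ _) _; rewrite (normrM sR) (normrM sL).
  have -> : G * G0 * h = G * (G0 * s') + G * (G0 * s) by rewrite -ss'; ring.
  by apply: lerD; exact: ler_pM.
have fdv : \sum_(k < p.+2) `|f (y + k%:R * h)| * `|d v k| <=
    F * (H0 * (p.+2%:R * h)) + G * rho * (2 * G0).
  have Gr0 : 0 <= G * rho := le_trans (normr_ge0 _) (fGr 0).
  (* The minimum allows F to be used against the term in H0 and G rho against the term in G0. *)
  pose m := Num.min F (G * rho).
  have m0 : 0 <= m by rewrite /m le_min F_0.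
  apply: le_trans (_ : m * \sum_(k < p.+2) `|d v k| <= _).
    rewrite mulr_sumr; apply: ler_sum => k _.
    by rewrite ler_wpM2r // /m le_min fF fGr.
  apply: le_trans (ler_wpM2l m0 dv_sum) _; rewrite mulrDr.
  by apply: lerD; rewrite ler_wpM2r ?mulr_ge0 ?(ltW h0) // /m ge_min lexx ?orbT.
apply: le_trans (_ : h / 4 * \sum_(k < p.+2) `|d (fun x => f x * v x) k| <= _).
  rewrite mulr_sumr; apply: ler_sum => k _.
  by rewrite defE normrM normrN (ger0_norm lah) ler_wpM2r.
have := ler_sum (index_enum 'I_p.+2) (fun (k : 'I_p.+2) (_ : true) => d_mul k).
rewrite big_split /= sumr_const card_ord -mulr_natl => dm.
have : G * rho * (2 * G0) <= G * (p.+2%:R * h / 2) * (2 * G0).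
  by rewrite ler_wpM2r ?mulr_ge0 // ler_wpM2l.
move=> rr.
have -> : e = h / 4 * (F * (H0 * (p.+2%:R * h)) + G * (p.+2%:R * h / 2) * (2 * G0)
   + p.+2%:R * (F0 * (H * h / 2) + G * G0 * h)).
  by rewrite /e; field.
rewrite ler_wpM2l ?divr_ge0 ?(ltW h0) //.
by move: dm fdv rr; lra.
Qed.

(** * Regularity along lines *)

Definition line {R : realType} (u : 'cV[R]_2 -> R) (q w : 'cV[R]_2) : R -> R :=
  fun x => u (q + x *: w).

Definition elipschitz {R : realType} (u : 'cV[R]_2 -> R) (G : R) : Prop :=
  forall x y, `|u x - u y| <= G * enorm (x - y).

Definition second_diff_bounded {R : realType} (u : 'cV[R]_2 -> R) (H : R) :
  Prop := forall q w, enorm w = 1 -> second_diff_le (line u q w) H.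

Definition line_var_bounded {R : realType} (u : 'cV[R]_2 -> R) (G H : R) :
  Prop := forall q w x n, enorm w = 1 -> increasing_nodes x n ->
  slope_var (line u q w) x n <= H * (x n - x 0%N) + 2 * G.

Lemma line_lip {R : realType} (u : 'cV[R]_2 -> R) (G : R) q w :
  elipschitz u G -> enorm w = 1 ->
  forall a b, `|line u q w a - line u q w b| <= G * `|a - b|.
Proof.
move=> uG w1 a b; apply: le_trans (uG _ _) _.
by rewrite opprD addrACA subrr add0r -scalerBl enormZ w1 mulr1.
Qed.

Lemma second_diff_line_var {R : realType} (u : 'cV[R]_2 -> R) (G H : R) :
  0 <= G -> 0 <= H -> elipschitz u G -> second_diff_bounded u H ->
  line_var_bounded u G H.
Proof.
move=> G0 H0 uG uH q w x n w1 xlt.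
by apply: slope_var_second_diff => //; [exact: line_lip | exact: uH].
Qed.

(** These bounds pass through every layer: they are stable under relu, translations, multiples and
    sums. *)
Record regular {R : realType} (u : 'cV[R]_2 -> R) (F G H : R) : Prop :=
  Regular {
    regular_G_ge0 : 0 <= G;
    regular_H_ge0 : 0 <= H;
    regular_bounded : forall x, `|u x| <= F;
    regular_lipschitz : elipschitz u G;
    regular_line_var : line_var_bounded u G H
  }.

Lemma regular_relu {R : realType} (u : 'cV[R]_2 -> R) (F G H : R) :
  regular u F G H -> regular (fun x => relu (u x)) F G H.
Proof.
move=> [G0 H0 uF uG uV]; split => // [x|x y|q w x n w1 xlt].
- apply: le_trans (uF x); rewrite /relu.
  by case: (leP (u x) 0) => xx; rewrite ?normr0.
- apply: le_trans (uG x y).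
  have a1 := ler_norm (u x - u y).
  have a2 := ler_norm (u y - u x); rewrite distrC in a2.
  rewrite ler_norml /relu; case: (leP (u x) 0) => xx; case: (leP (u y) 0) => yy;
    by apply/andP; split; lra.
- apply: le_trans (uV q w x n w1 xlt).
  exact: (slope_var_relu (line u q w)).
Qed.

Lemma regular_scale_shift {R : realType} (u : 'cV[R]_2 -> R) (F G H a C : R)
    (z : 'cV[R]_2) : `|a| <= C -> regular u F G H ->
  regular (fun x => a * u (x - z)) (C * F) (C * G) (C * H).
Proof.
move=> aC [G0 H0 uF uG uV]; have C0 : 0 <= C := le_trans (normr_ge0 _) aC.
split => [||x|x y|q w x n w1 xlt]; rewrite ?mulr_ge0 //.
- by rewrite normrM ler_pM.
- rewrite -mulrBr normrM -mulrA ler_pM // (le_trans (uG _ _)) //.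
  by rewrite opprB addrA subrK.
- have -> : line (fun x => a * u (x - z)) q w =
      (fun y => a * line u (q - z) w y).
    by apply: funext => y; rewrite /line addrAC.
  rewrite slope_varZ.
  have -> : C * H * (x n - x 0%N) + 2 * (C * G) =
    C * (H * (x n - x 0%N) + 2 * G) by ring.
  rewrite ler_pM // ?uV //.
  by rewrite /slope_var sumr_ge0.
Qed.

(** Only an upper bound n on the length is asked for, so that n can be t for the duplicate-free list
    of rotations. *)
Lemma regular_sum {R : realType} (I : eqType) (s : seq I)
    (u : I -> 'cV[R]_2 -> R) (F G H : R) (n : nat) :
  (size s <= n)%N -> 0 <= F -> 0 <= G -> 0 <= H ->
  (forall i, i \in s -> regular (u i) F G H) ->
  regular (fun x => \sum_(i <- s) u i x) (n%:R * F) (n%:R * G) (n%:R * H).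
Proof.
move=> sn F0 G0 H0 us.
have sum_le (f : I -> R) C : 0 <= C -> (forall i, i \in s -> f i <= C) ->
    \sum_(i <- s) f i <= n%:R * C.
  move=> C0 fC; apply: le_trans (_ : (size s)%:R * C <= _).
    rewrite big_seq; apply: le_trans (ler_sum _ fC) _.
    by rewrite -big_seq big_const_seq count_predT iter_addr_0 mulr_natl.
  by rewrite ler_wpM2r // ler_nat.
split => [||x|x y|q w x m w1 xlt]; rewrite ?mulr_ge0 //.
- apply: le_trans (ler_norm_sum _ _ _) _; apply: sum_le => // i /us [].
  by move=> _ _ + _ _; apply.
- rewrite -sumrB; apply: le_trans (ler_norm_sum _ _ _) _; rewrite -mulrA.
  apply: sum_le; first by rewrite mulr_ge0 // enorm_ge0.
  by move=> i /us [_ _ _ + _]; apply.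
- apply: le_trans (slope_var_sum s (fun i => line (u i) q w) x m) _.
  have -> : n%:R * H * (x m - x 0%N) + 2 * (n%:R * G) =
    n%:R * (H * (x m - x 0%N) + 2 * G) by ring.
  apply: sum_le; last by move=> i /us [_ _ _ _]; apply.
  rewrite addr_ge0 ?mulr_ge0 // subr_ge0.
  elim: m xlt => // m IH xlt.
  apply: le_trans (IH _) (ltW (xlt m _)) => // k km.
  by apply: xlt; exact: ltnW.
Qed.

(** * Regularity along lines from bounds on the gradient and the Hessian *)

Definition line_slope {R : realType} (f : 'cV[R]_2 -> R) (w x : 'cV[R]_2) : R :=
  \sum_(i < 2) w i 0 * partial i f x.

Lemma is_derive_line {R : realType} (f : 'cV[R]_2 -> R) (q w : 'cV[R]_2)
    (x : R) : differentiable f (q + x *: w) ->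
  is_derive x 1 (line f q w) (line_slope f w (q + x *: w)).
Proof.
move=> df.
have -> : line_slope f w (q + x *: w) = 'D_w f (q + x *: w).
  rewrite /line_slope /partial deriveE //; move: df; set z := q + _ => df.
  have wE : w = \sum_(i < 2) w i 0 *: delta_mx i 0.
    rewrite [LHS]vec2_eta [RHS]vec2_eta !summxE !big_ord_recl !big_ord0.
    rewrite !mxE /= !(mulr1, mulr0, addr0, add0r).
    by congr (vec2 _ (w _ _)); exact/val_inj.
  rewrite [in RHS]wE.
  rewrite linear_sum; apply: eq_bigr => i _.
  by rewrite linearZ deriveE.
(* The difference quotients of the restriction to the line are those of f in direction w. *)
have E : (fun h : R => h^-1 *: ((line f q w \o shift x) (h *: (1 : R)) -
      line f q w x)) =
    (fun h : R => h^-1 *: ((f \o shift (q + x *: w)) (h *: w) -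
      f (q + x *: w))).
  apply: funext => h /=; rewrite /line; congr (_ *: (f _ - _)).
  by rewrite [h *: 1]mulr1 scalerDl addrCA addrC.
have dw : derivable f (q + x *: w) w by exact: diff_derivable.
split; first by rewrite /derivable E.
by rewrite /derive E.
Qed.

Lemma enorm_cauchy {R : realType} (v w : 'cV[R]_2) :
  `|\sum_(i < 2) v i 0 * w i 0| <= enorm v * enorm w.
Proof.
have cs (u : 'cV[R]_2) : \sum_(i < 2) u i 0 * w i 0 <= enorm u * enorm w.
  rewrite [in leRHS](vec2_eta u) [in leRHS](vec2_eta w).
  apply: le_trans (cauchy_schwarz2 _ _ _ _).
  rewrite big_ord_recl big_ord1.
  by have -> : lift ord0 ord0 = ord_max :> 'I_2 by exact/val_inj.
rewrite ler_norml cs andbT lerNl -(enormN v); apply: le_trans (cs _).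
by rewrite -sumrN ler_sum // => i _; rewrite mxE mulNr.
Qed.

Lemma line_slope_le {R : realType} (f : 'cV[R]_2 -> R) (w x : 'cV[R]_2) :
  `|line_slope f w x| <= enorm w * enorm (gradient f x).
Proof.
have -> : line_slope f w x = \sum_(i < 2) w i 0 * gradient f x i 0.
  by apply: eq_bigr => i _; rewrite mxE.
exact: enorm_cauchy.
Qed.

Lemma enorm_le_opnorm {R : realType} (M : 'M[R]_2) (v : 'cV[R]_2) :
  enorm v <= 1 -> enorm (M *m v) <= opnorm M.
Proof.
move=> v1; apply: ub_le_sup; last by exists v.
(* The supremum dominates its elements once the set is bounded above; the sum of the absolute
   entries is such a bound. *)
exists (\sum_(i < 2) \sum_(j < 2) `|M i j|) => _ [u /= u1 <-].
rewrite [M *m u]vec2_eta; apply: le_trans (enorm_vec2_le _ _) _.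
rewrite [leRHS]big_ord_recl big_ord1.
have -> : lift ord0 ord0 = ord_max :> 'I_2 by exact/val_inj.
have row i : `|(M *m u) i 0| <= \sum_(j < 2) `|M i j|.
  rewrite mxE; apply: le_trans (ler_norm_sum _ _ _) _; apply: ler_sum => j _.
  by rewrite normrM ler_piMr //; exact: le_trans (coord_enorm _ _) u1.
exact: lerD.
Qed.

Lemma opnorm_ge0 {R : realType} (M : 'M[R]_2) : 0 <= opnorm M.
Proof.
have := @enorm_le_opnorm R M 0; rewrite enorm0 ler01 => /(_ isT).
by rewrite mulmx0 enorm0.
Qed.

(** The left side is the quadratic form of the Hessian at w, so the Cauchy-Schwarz inequality
    applies to w and its image. *)
Lemma line_slope2_le {R : realType} (f : 'cV[R]_2 -> R) (w x : 'cV[R]_2) :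
  enorm w = 1 ->
  `|\sum_(i < 2) w i 0 * line_slope (partial i f) w x| <= opnorm (hessian f x).
Proof.
move=> w1; rewrite /line_slope.
have -> : \sum_(i < 2) w i 0 * \sum_(j < 2) w j 0 * partial j (partial i f) x =
    \sum_(j < 2) w j 0 * (hessian f x *m w) j 0.
  under eq_bigr do rewrite mulr_sumr.
  rewrite exchange_big; apply: eq_bigr => j _; rewrite mxE mulr_sumr.
  by apply: eq_bigr => i _; rewrite mxE; ring.
apply: le_trans (enorm_cauchy _ _) _.
by rewrite w1 mul1r enorm_le_opnorm ?w1.
Qed.

Lemma MVT_line {R : realType} (g dg : R -> R) (a b : R) :
  (forall x : R, is_derive x 1 g (dg x)) -> a < b ->
  exists2 c, a < c < b & g b - g a = dg c * (b - a).
Proof.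
move=> gd ab.
have [|c ci cE] := @MVT R g dg a b ab (fun x _ => gd x).
  by apply: derivable_within_continuous => x _; have [] := gd x.
by exists c; first by rewrite in_itv in ci.
Qed.

Lemma C1_elipschitz {R : realType} (f : 'cV[R]_2 -> R) (G : R) :
  (forall x, differentiable f x) -> (forall x, enorm (gradient f x) <= G) ->
  elipschitz f G.
Proof.
move=> df fG x y.
have gd (t : R) := is_derive_line (q := y) (w := x - y) (df (y + t *: (x - y))).
have [c _] := MVT_line gd ltr01.
rewrite /line scale1r scale0r addr0 [y + _]addrC subrK subr0 mulr1 => ->.
apply: le_trans (line_slope_le _ _ _) _.
by rewrite mulrC ler_wpM2r // enorm_ge0.
Qed.

Lemma C2_second_diff {R : realType} (f : 'cV[R]_2 -> R) (H : R) :
  (forall x, differentiable f x) ->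
  (forall i x, differentiable (partial i f) x) ->
  (forall x, opnorm (hessian f x) <= H) ->
  second_diff_bounded f H.
Proof.
move=> df ddf fH q w w1 a b c ab bc; set g := line f q w.
pose dg x := line_slope f w (q + x *: w).
have gd (t : R) : is_derive t 1 g (dg t) by exact: is_derive_line.
pose ddg x := \sum_(i < 2) w i 0 * line_slope (partial i f) w (q + x *: w).
have dgd (t : R) : is_derive t 1 dg (ddg t).
  have -> : dg = \sum_(i < 2) (fun x => w i 0 * line (partial i f) q w x).
    by apply: funext => x; rewrite fct_sumE.
  apply: is_derive_sum => i.
  have := is_derive_line (ddf i (q + t *: w)); exact: is_deriveZ.
have dgH (x y : R) : x < y -> `|dg y - dg x| <= H * (y - x).
  move=> xy; have [z _ ->] := MVT_line dgd xy.
  rewrite normrM (gtr0_norm (_ : 0 < y - x)) ?subr_gt0 //.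
  rewrite ler_wpM2r ?subr_ge0 ?(ltW xy) //.
  exact: le_trans (line_slope2_le _ _ w1) (fH _).
(* [H x^2 / 2 + s g x] is convex for [s = 1] and [s = -1] *)
have conv (s : R) : `|s| = 1 ->
    0 <= H * (c - a) / 2 + s * ((g c - g b) / (c - b) - (g b - g a) / (b - a)).
  move=> s1; pose k x := H / 2 * x ^+ 2 + s * g x.
  have kd (t : R) : is_derive t 1 k (H * t + s * dg t).
    have h1 : is_derive t 1 (fun x : R => H / 2 * x ^+ 2) (H * t).
      have -> : (fun x : R => H / 2 * x ^+ 2) =
          (H / 2) \*: ((id : R -> R) * id).
        by apply: funext => x; rewrite expr2.
      apply: is_derive_eq; rewrite /GRing.scale /=; lra.
    have h2 : is_derive t 1 (fun x : R => s * g x) (s * dg t).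
      exact: is_deriveZ.
    exact: is_deriveD.
  have [y /andP[y1 y2] yE] := MVT_line kd ab.
  have [z /andP[z1 z2] zE] := MVT_line kd bc.
  have yz : y < z := lt_trans y2 z1.
  have : 0 <= (H * z + s * dg z) - (H * y + s * dg y).
    have := dgH _ _ yz; have := normrM s (dg z - dg y); rewrite s1 mul1r => <-.
    by rewrite ler_norml => /andP[+ _]; lra.
  have <- : (k c - k b) / (c - b) = H * z + s * dg z.
    by rewrite zE mulfK // subr_eq0 gt_eqF.
  have <- : (k b - k a) / (b - a) = H * y + s * dg y.
    by rewrite yE mulfK // subr_eq0 gt_eqF.
  rewrite /k; move/le_trans; apply; rewrite le_eqVlt; apply/orP; left.
  by apply/eqP; field; rewrite !subr_eq0 !gt_eqF.
rewrite ler_norml; apply/andP; split.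
  by have := conv 1; rewrite normr1 mul1r => /(_ erefl); lra.
by have := conv (-1); rewrite normrN1 mulN1r => /(_ erefl); lra.
Qed.

(** * Rotating a filter sum *)

Definition grid_seq {R : realType} (h : R) (p : nat) : seq 'cV[R]_2 :=
  [seq gridpt h p p k l | k <- iota 1 p, l <- iota 1 p].

(** Duplicates are removed so that sums over the list are sums over the set. *)
Definition rotgrp_seq (R : realType) (t : nat) : seq 'M[R]_2 :=
  undup [seq rot (2 * pi * k%:R / t%:R) | k <- iota 1 t].

Lemma gridptE {R : realType} (h : R) (p k l : nat) :
  gridpt h p p k l = vec2 (- (p.+1%:R * h / 2) + k%:R * h)
    (- (p.+1%:R * h / 2) + l%:R * h).
Proof.
have E (m : nat) : (m%:R - p.+1%:R / 2) * h = - (p.+1%:R * h / 2) + m%:R * h.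
  by ring.
by rewrite /gridpt !E.
Qed.

Lemma size_grid_seq {R : realType} (h : R) (p : nat) :
  size (grid_seq h p) = (p ^ 2)%N.
Proof. by rewrite size_allpairs size_iota expnS expn1. Qed.

Lemma filter_grid_big {R : realType} (h : R) (p : nat) (f : 'cV[R]_2 -> R) :
  0 < h ->
  \sum_(delta \in filter_grid h p) f delta = \sum_(delta <- grid_seq h p) f delta.
Proof.
move=> h0.
have -> : filter_grid h p = [set` grid_seq h p].
  apply/seteqP; split => v /=.
    move=> [k kp [l lp <-]]; apply/allpairsP; exists (k, l) => /=.
    by rewrite !mem_iota !add1n !ltnS.
  move=> /allpairsP[[k l] /=]; rewrite !mem_iota !add1n !ltnS => -[kp lp ->].
  by exists k => //; exists l.
rewrite -fsbig_seq //.
apply: allpairs_uniq; rewrite ?iota_uniq // => -[k l] [k' l'] _ _ /=.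
rewrite !gridptE => /matrixP E.
have inj (i j : nat) : - (p.+1%:R * h / 2) + i%:R * h =
    - (p.+1%:R * h / 2) + j%:R * h -> i = j.
  move=> /addrI /mulIf; rewrite gt_eqF // => /(_ isT) /eqP.
  by rewrite eqr_nat => /eqP.
have := E ord0 0; have := E ord_max 0; rewrite !vec2E => e2 e1.
by congr pair; exact: inj.
Qed.

Lemma grid_seq_norm {R : realType} (h : R) (p : nat) (v : 'cV[R]_2) :
  0 < h -> v \in grid_seq h p -> enorm v <= p%:R * h.
Proof.
move=> h0 /allpairsP[[k l] /=]; rewrite !mem_iota !add1n !ltnS.
move=> [/andP[k1 kp] /andP[l1 lp] ->]; rewrite gridptE.
apply: le_trans (enorm_vec2_le _ _) _.
have bnd (i : nat) : (1 <= i)%N -> (i <= p)%N ->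
    `|- (p.+1%:R * h / 2) + i%:R * h| <= p%:R * h / 2.
  move=> i1 ip; have : 1 * h <= i%:R * h by rewrite ler_pM2r // ler1n.
  have : i%:R * h <= p%:R * h by rewrite ler_pM2r // ler_nat.
  rewrite -natr1 mulrDl mul1r ler_norml => ? ?.
  by apply/andP; split; lra.
by have := bnd _ k1 kp; have := bnd _ l1 lp; lra.
Qed.

(** The square lattice with p + 2 nodes per side adds to the filter grid a rim at sup-distance (p +
    1) h / 2 from the centre, where psi vanishes. *)
Lemma grid_seq_sum {R : realType} (h : R) (p : nat) (psi : 'cV[R]_2 -> R) :
  0 < h -> (forall y, p.+1%:R * h / 2 <= enorm y -> psi y = 0) ->
  let al := - (p.+1%:R * h / 2) in
  \sum_(k < p.+2) \sum_(l < p.+2) psi (vec2 (al + k%:R * h) (al + l%:R * h)) =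
  \sum_(v <- grid_seq h p) psi v.
Proof.
move=> h0 supp; cbv zeta; set al := - _.
have rim (F : nat -> R) : F 0%N = 0 -> F p.+1 = 0 ->
    \sum_(k < p.+2) F k = \sum_(k <- iota 1 p) F k.
  move=> F0 F1; rewrite big_ord_recl big_ord_recr /= F0 add0r.
  rewrite /bump /= add1n F1 addr0 -(big_mkord xpredT (fun k => F k.+1)).
  have -> : iota 1 p = index_iota 1 p.+1 by rewrite /index_iota subn1.
  by rewrite big_add1.
have edge (a b : R) : p.+1%:R * h / 2 <= `|a| \/ p.+1%:R * h / 2 <= `|b| ->
    psi (vec2 a b) = 0.
  move=> ab; apply: supp; case: ab => /le_trans; apply.
    by have := coord_enorm (vec2 a b) ord0; rewrite mxE.
  by have := coord_enorm (vec2 a b) ord_max; rewrite mxE.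
have e0 : p.+1%:R * h / 2 <= `|al + 0%:R * h|.
  by rewrite mul0r addr0 /al normrN ler_norm.
have e1 : p.+1%:R * h / 2 <= `|al + p.+1%:R * h|.
  by apply: le_trans (ler_norm _); rewrite /al; lra.
rewrite big_allpairs_dep (rim (fun k : nat => \sum_(l < p.+2)
   psi (vec2 (al + k%:R * h) (al + l%:R * h)))).
- apply: eq_bigr => k _.
  rewrite (rim (fun l : nat => psi (vec2 (al + k%:R * h) (al + l%:R * h)))).
  + by apply: eq_bigr => l _; rewrite gridptE.
  + by apply: edge; right.
  + by apply: edge; right.
- by rewrite big1 // => l _; apply: edge; left.
- by rewrite big1 // => l _; apply: edge; left.
Qed.

(** The difference of the rotations is c I + s J with J the quarter turn, and |c| and |s| are at
    most |a - b|. The resulting factor 2 is the one in front of N in [const2]. *)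
Lemma rot_sub_le {R : realType} (a b : R) (v : 'cV[R]_2) :
  enorm (rot a *m v - rot b *m v) <= 2 * `|a - b| * enorm v.
Proof.
have lip (f g : R -> R) : (forall x : R, is_derive x 1 f (g x)) ->
    (forall x, `|g x| <= 1) -> `|f a - f b| <= `|a - b|.
  move=> fd g1; case: (ltgtP a b) => [ab|ba|->]; last by rewrite !subrr.
    have [c _] := MVT_line fd ab; rewrite distrC => ->.
    by rewrite normrM [leRHS]distrC ler_piMl.
  by have [c _ ->] := MVT_line fd ba; rewrite normrM ler_piMl.
have dc : `|cos a - cos b| <= `|a - b|.
  apply: (lip cos (fun x => - sin x)) => x; rewrite normrN.
  by rewrite ler_norml sin_geN1 sin_le1.
have ds : `|sin a - sin b| <= `|a - b|.
  by apply: (lip sin cos) => x; rewrite ler_norml cos_geN1 cos_le1.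
move: dc ds; set c := cos a - cos b; set s := sin a - sin b => dc ds.
rewrite [v]vec2_eta !mul_rot_vec2 vec2N vec2D.
set x := v _ _; set y := v _ _.
have -> : vec2 (cos a * x - sin a * y + - (cos b * x - sin b * y))
    (sin a * x + cos a * y + - (sin b * x + cos b * y)) =
    c *: vec2 x y + s *: vec2 (- y) x.
  by rewrite !vec2Z vec2D /c /s; congr vec2; ring.
apply: le_trans (enormD _ _) _; rewrite !enormZ.
have -> : enorm (vec2 (- y) x) = enorm (vec2 x y).
  by rewrite !enorm_vec2 sqrrN addrC.
by rewrite -mulrDl ler_wpM2r ?enorm_ge0 //; lra.
Qed.

(** Every point of the disc is within rho of the circle of radius rho, where phi vanishes: it is
    projected radially, and the centre is sent to (rho, 0). *)
Lemma sup_le_lipschitz_radius {R : realType} (phi : 'cV[R]_2 -> R) (G rho : R) :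
  0 <= G -> 0 <= rho -> elipschitz phi G ->
  (forall y, rho <= enorm y -> phi y = 0) ->
  forall y, `|phi y| <= G * rho.
Proof.
move=> G0 rho0 phiG supp y.
have [far|near] := leP rho (enorm y); first by rewrite supp // normr0 mulr_ge0.
suff [z zr yz] : exists2 z : 'cV[R]_2, rho <= enorm z & enorm (y - z) <= rho.
  rewrite -[phi y]subr0 -(supp z zr); apply: le_trans (phiG _ _) _.
  exact: ler_wpM2l.
have [y0|y0] := eqVneq (enorm y) 0.
  have e : enorm (vec2 rho 0) = rho.
    by rewrite enorm_vec2 expr0n addr0 sqrtr_sqr ger0_norm.
  exists (vec2 rho 0); first by rewrite e.
  have := enormD y (- vec2 rho 0); rewrite enormN e y0; lra.
have yp : 0 < enorm y by rewrite lt_neqAle eq_sym y0 enorm_ge0.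
exists ((rho / enorm y) *: y).
  by rewrite enormZ ger0_norm ?divr_ge0 ?enorm_ge0 // divfK.
rewrite -{1}[y]scale1r -scalerBl enormZ distrC ger0_norm; last first.
  by rewrite subr_ge0 ler_pdivlMr // mul1r ltW.
by rewrite mulrBl divfK // mul1r gerBl enorm_ge0.
Qed.

Record filter_regular {R : realType} (phi : 'cV[R]_2 -> R) (F G H rho : R) :
  Prop := FilterRegular {
    filter_G_ge0 : 0 <= G;
    filter_H_ge0 : 0 <= H;
    filter_bounded : forall x, `|phi x| <= F;
    filter_lipschitz : elipschitz phi G;
    filter_second_diff : second_diff_bounded phi H;
    filter_support : forall x, rho <= enorm x -> phi x = 0
  }.

(** [lattice_rotation] for psi(y) = phi (rot tau y) u (x - y), with the interpolation error supplied
    by [interp_var_mul]. *)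
Lemma grid_rotation {R : realType} (phi u : 'cV[R]_2 -> R) (h : R) (p : nat)
    (F G H F0 G0 H0 kappa tau : R) (x : 'cV[R]_2) :
  0 < h -> (0 < p)%N ->
  filter_regular phi F G H (p.+1%:R * h / 2) -> regular u F0 G0 H0 ->
  `|\sum_(v <- grid_seq h p)
      phi (rot (tau + kappa) *m v) * u (x - rot kappa *m v) -
    \sum_(v <- grid_seq h p) phi (rot tau *m v) * u (x - v)|
  <= 4 * p%:R ^+ 2 * h ^+ 2 * (F0 * H / 2 + 2 * G * G0 + F * H0).
Proof.
move=> h0 p0 [G_0 H_0 phiF phiG phiH supp] [G0_0 H0_0 uF uG uV].
set rho := p.+1%:R * h / 2 in supp.
have rho0 : 0 <= rho by rewrite /rho divr_ge0 // mulr_ge0 // ltW.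
pose psi y := phi (rot tau *m y) * u (x - y).
have psi_supp y : rho <= enorm y -> psi y = 0.
  by move=> yr; rewrite /psi supp ?mul0r // enorm_rot.
have F_0 : 0 <= F := le_trans (normr_ge0 _) (phiF 0).
have F0_0 : 0 <= F0 := le_trans (normr_ge0 _) (uF 0).
set M := _ + F * H0.
have M0 : 0 <= M by rewrite /M !addr_ge0 ?divr_ge0 ?mulr_ge0.
have -> : \sum_(v <- grid_seq h p)
      phi (rot (tau + kappa) *m v) * u (x - rot kappa *m v) =
    \sum_(v <- grid_seq h p) psi (rot kappa *m v).
  by apply: eq_bigr => v _; rewrite /psi mulmxA rotD.
(* For p = 1 the only grid point is 0, which rotations fix. For p >= 2 one has p + 2 <= 2p, which
   turns (p + 2)^2 into 4 p^2. *)
have [p1|p2] := leqP p 1.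
  have -> : p = 1%N by lia.
  rewrite /grid_seq !big_seq1 gridptE.
  have -> : - (2%:R * h / 2) + 1%:R * h = 0 :> R by lra.
  have -> : vec2 0 0 = 0 :> 'cV[R]_2 by rewrite [RHS]vec2_eta !mxE.
  by rewrite mulmx0 subrr normr0 !mulr_ge0 // ltW.
have psiC y : `|psi y| <= F * F0 by rewrite normrM ler_pM.
have psie q w : enorm w = 1 -> interp_var (fun s => psi (q + s *: w)) h p.+2
    (p.+2%:R * h ^+ 2 / 4 * M).
  move=> w1.
  have -> : (fun s => psi (q + s *: w)) = (fun s =>
      line phi (rot tau *m q) (rot tau *m w) s * line u (x - q) (- w) s).
    apply: funext => s; rewrite /psi /line mulmxDr scalemxAr.
    by rewrite scalerN opprD addrA.
  have w1' : enorm (rot tau *m w) = 1 by rewrite enorm_rot.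
  have w1'' : enorm (- w) = 1 by rewrite enormN.
  apply: (@interp_var_mul _ _ _ h rho) => //.
  - by rewrite /rho -!mulrA ler_wpM2r ?ler_nat // divr_ge0 ?(ltW h0).
  - by move=> s; exact: phiF.
  - by move=> s; exact: (sup_le_lipschitz_radius G_0 rho0 phiG supp).
  - exact: line_lip.
  - exact: phiH.
  - by move=> s; exact: uF.
  - exact: line_lip.
  - by move=> y n yn; exact: uV.
have := lattice_rotation kappa h0 psi_supp psiC psie; cbv zeta.
rewrite grid_seq_sum //.
rewrite (grid_seq_sum (psi := fun y => psi (rot kappa *m y))) //; last first.
  by move=> y yr; apply: psi_supp; rewrite enorm_rot.
move=> /le_trans; apply.
have -> : 4 * p.+2%:R * (p.+2%:R * h ^+ 2 / 4 * M) =
  p.+2%:R ^+ 2 * (h ^+ 2 * M) by field.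
have -> : 4 * p%:R ^+ 2 * h ^+ 2 * M = (2 * p)%:R ^+ 2 * (h ^+ 2 * M).
  by rewrite natrM; ring.
rewrite ler_wpM2r ?(mulr_ge0, sqr_ge0, ltW h0) // ler_pXn2r ?nnegrE // ler_nat.
by clear -p2; lia.
Qed.

(** * The rotation group and the approximation of an angle by its elements *)

Lemma rot_periodic {R : realType} (a : R) : rot (a + 2 * pi) = rot a.
Proof.
apply/matrixP => i j; rewrite !mxE.
have -> : 2 * pi = pi *+ 2 :> R by rewrite mulr_natl.
by rewrite cosD2pi sinD2pi.
Qed.

Lemma size_rotgrp_seq (R : realType) (t : nat) : (size (rotgrp_seq R t) <= t)%N.
Proof. by apply: leq_trans (size_undup _) _; rewrite size_map size_iota. Qed.

Lemma rotgrp_seqP (R : realType) (t : nat) (A : 'M[R]_2) :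
  A \in rotgrp_seq R t <-> rotgrp R t A.
Proof.
rewrite mem_undup; split.
  by move=> /mapP[k]; rewrite mem_iota add1n ltnS => kt ->; exists k.
by move=> [k kt <-]; apply/mapP; exists k; rewrite // mem_iota add1n ltnS.
Qed.

Lemma rotgrp_big (R : realType) (t : nat) (f : 'M[R]_2 -> R) :
  \sum_(A \in rotgrp R t) f A = \sum_(A <- rotgrp_seq R t) f A.
Proof.
have -> : rotgrp R t = [set` rotgrp_seq R t].
  by apply/seteqP; split => A /rotgrp_seqP.
by rewrite -fsbig_seq // undup_uniq.
Qed.

Lemma rotgrp_seq_rot (R : realType) (t : nat) (A : 'M[R]_2) :
  A \in rotgrp_seq R t -> exists a, A = rot a.
Proof. by move=> /rotgrp_seqP[k _ <-]; eexists. Qed.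

(** Multiplication by the inverse of a group element is an injective map of the list into itself,
    hence a permutation of it. *)
Lemma rotgrp_translate (R : realType) (t k : nat) (f : 'M[R]_2 -> R) :
  (1 <= k <= t)%N ->
  \sum_(B <- rotgrp_seq R t) f (rot (- (2 * pi * k%:R / t%:R)) *m B) =
  \sum_(B <- rotgrp_seq R t) f B.
Proof.
move=> /andP[k1 kt]; set K := rot _.
rewrite -(big_map (fun B => K *m B) xpredT f); apply: perm_big.
have uK : uniq [seq K *m B | B <- rotgrp_seq R t].
  rewrite map_inj_uniq ?undup_uniq // => B C.
  by move=> /(congr1 (mulmx (invmx K))); rewrite !mulKmx // rot_unit.
suff sub : {subset [seq K *m B | B <- rotgrp_seq R t] <= rotgrp_seq R t}.
  apply: uniq_perm => //; first exact: undup_uniq.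
  by have [|] := uniq_min_size uK sub; rewrite ?size_map.
move=> _ /mapP[B /rotgrp_seqP[j /= /andP[j1 jt] <-] ->]; apply/rotgrp_seqP.
rewrite rotD; have t0 : t%:R != 0 :> R by rewrite pnatr_eq0; lia.
(* The representative of j - k modulo t is taken among 1, ..., t. *)
have [kj|jk] := ltnP k j.
  exists (j - k)%N => /=; first by lia.
  by congr rot; rewrite natrB 1?ltnW //; ring.
exists (j + t - k)%N => /=; first by lia.
rewrite -[RHS]rot_periodic; congr rot.
by rewrite natrB ?natrD; [field | lia].
Qed.

Lemma nearest_rotation (R : realType) (t : nat) (theta : R) :
  (0 < t)%N -> 0 <= theta -> theta <= 2 * pi ->
  exists2 k : nat, (1 <= k <= t)%N &
    `|theta - 2 * pi * k%:R / t%:R| <= 2 * pi / t%:R.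
Proof.
move=> t0 th0 th1.
have tp : 0 < t%:R :> R by rewrite ltr0n.
have pip : 0 < 2 * pi :> R by rewrite mulr_gt0 // pi_gt0.
pose s : R := 2 * pi / t%:R.
have s0 : 0 < s by rewrite divr_gt0.
have ts : t%:R * s = 2 * pi by rewrite /s mulrC divfK // gt_eqF.
have kE (k : nat) : 2 * pi * k%:R / t%:R = k%:R * s by rewrite /s; ring.
have z0 : 0 <= theta / s by rewrite divr_ge0 // ltW.
have /andP[] := truncn_itv z0; set j := Num.truncn _ => jle jgt.
have jle' : j%:R * s <= theta by rewrite -ler_pdivlMr.
have jgt' : theta < j.+1%:R * s by rewrite -ltr_pdivrMr.
have jt : (j <= t)%N.
  by rewrite -(ler_nat R) -(ler_pM2r s0) ts (le_trans jle').
move: jgt'; rewrite -natr1 mulrDl mul1r => jgt'.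
(* The angle is rounded up, as j may be 0, which is not an admissible index. If j = t, then theta =
   2 pi and k = t is exact. *)
have [jlt|tj] := ltnP j t.
  exists j.+1; first by [].
  by rewrite kE -/s -natr1 mulrDl mul1r ler_norml; apply/andP; split; lra.
have jE : j = t by apply/eqP; rewrite eqn_leq jt tj.
exists t; first by rewrite t0 leqnn.
rewrite jE ts in jle'.
by rewrite kE -/s ts ler_norml; apply/andP; split; lra.
Qed.

(** * Equivariance error of a single filter sum *)

Lemma norm_sum_le {R : realType} (I : eqType) (s : seq I) (f : I -> R) (C : R)
    (n : nat) : (size s <= n)%N -> 0 <= C -> (forall i, i \in s -> `|f i| <= C) ->
  `|\sum_(i <- s) f i| <= n%:R * C.
Proof.
move=> sn C0 fC; apply: le_trans (ler_norm_sum _ _ _) _.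
rewrite big_seq; apply: le_trans (ler_sum _ fC) _.
rewrite -big_seq big_const_seq count_predT iter_addr_0 -[X in X <= _]mulr_natl.
by rewrite ler_wpM2r // ler_nat.
Qed.

Lemma relu_lip {R : realType} (a b : R) : `|relu a - relu b| <= `|a - b|.
Proof.
have a1 := ler_norm (a - b).
have a2 := ler_norm (b - a); rewrite distrC in a2.
rewrite ler_norml /relu; case: (leP a 0) => ?; case: (leP b 0) => ?;
  by apply/andP; split; lra.
Qed.

(** Three errors add up: the error E inherited by v, the Lipschitz cost of replacing theta by kappa
    at grid points of norm at most ph, and the quadrature error of a rotation by kappa. *)
Lemma kernel_error {R : realType} (phi u v : 'cV[R]_2 -> R) (h : R) (p : nat)
    (F G H F0 G0 H0 theta kappa beta eta E : R) (x : 'cV[R]_2) :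
  0 < h -> (0 < p)%N -> 0 < F ->
  filter_regular phi F G H (p.+1%:R * h / 2) -> regular u F0 G0 H0 ->
  `|theta - kappa| <= eta ->
  (forall z, `|v z - u (x - rot (- theta) *m z)| <= E) ->
  `|\sum_(z <- grid_seq h p) phi (invmx (rot beta) *m z) * v z -
    \sum_(z <- grid_seq h p) phi (invmx (rot (beta - kappa)) *m z) * u (x - z)|
  <= p%:R ^+ 2 * F * (E + (2 * eta * (p%:R * h) * G0 +
       4 * h ^+ 2 * (F0 * H / F + 2 * (G / F * G0) + H0))).
Proof.
move=> h0 p0 Fpos phiR uR thk vE.
have [G_0 H_0 phiF _ _ _] := phiR; have [G0_0 H0_0 uF uG _] := uR.
have F0_0 : 0 <= F0 := le_trans (normr_ge0 _) (uF 0).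
have E0 : 0 <= E := le_trans (normr_ge0 _) (vE 0).
have eta0 : 0 <= eta := le_trans (normr_ge0 _) thk.
(* Intermediate sum with exact features at points rotated by - kappa. The angle kappa - beta - kappa
   is kept in the form required by [grid_rotation] with tau = kappa - beta. *)
pose Q := \sum_(z <- grid_seq h p)
  phi (rot (kappa - beta - kappa) *m z) * u (x - rot (- kappa) *m z).
apply: le_trans (ler_distD Q _ _) _.
have -> : p%:R ^+ 2 * F * (E + (2 * eta * (p%:R * h) * G0 +
       4 * h ^+ 2 * (F0 * H / F + 2 * (G / F * G0) + H0))) =
    (p ^ 2)%:R * (F * (E + 2 * eta * (p%:R * h) * G0)) +
    4 * p%:R ^+ 2 * h ^+ 2 * (F0 * H + 2 * G * G0 + F * H0).
  by rewrite natrX; field; rewrite gt_eqF.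
apply: lerD.
  rewrite /Q -sumrB; apply: norm_sum_le; rewrite ?size_grid_seq //.
    by rewrite !mulr_ge0 ?addr_ge0 ?mulr_ge0 ?(ltW Fpos) ?(ltW h0).
  move=> z zg; rewrite rotV.
  have -> : kappa - beta - kappa = - beta by ring.
  rewrite -mulrBr normrM ler_pM //.
  apply: le_trans (ler_distD (u (x - rot (- theta) *m z)) _ _) _.
  rewrite lerD // (le_trans (uG _ _)) // mulrC ler_wpM2r //.
  have -> : x - rot (- theta) *m z - (x - rot (- kappa) *m z) =
      rot (- kappa) *m z - rot (- theta) *m z.
    by rewrite opprB addrC addrA subrK.
  apply: le_trans (rot_sub_le _ _ _) _.
  rewrite ler_pM ?enorm_ge0 ?mulr_ge0 ?grid_seq_norm //.
  by rewrite ler_pM2l // opprK addrC.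
have := grid_rotation (- kappa) (kappa - beta) x h0 p0 phiR uR.
rewrite -/Q rotV opprB => /le_trans; apply.
(* The term F0 H / 2 is weakened to F0 H. *)
rewrite ler_wpM2l ?(mulr_ge0, sqr_ge0, ltW h0) // !lerD2r.
by rewrite ler_pdivrMr // ler_peMr ?mulr_ge0 // ler1n.
Qed.

(** * Propagation through the network *)

Section network.

Context {R : realType} {N n0 nN : nat} (p t : nat) (h : R)
  (net : eqcnn R N n0 nN) (r : 'I_n0 -> 'cV[R]_2 -> R) (F G Hs : nat -> R).
Context (h_gt0 : 0 < h) (p_gt0 : (0 < p)%N) (t_gt0 : (0 < t)%N)
  (n0_gt0 : (0 < n0)%N) (N_ge2 : (2 <= N)%N)
  (F_gt0 : forall i, (1 <= i <= N)%N -> 0 < F i)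
  (r_reg : forall c, regular (r c) (F 0%N) (G 0%N) (Hs 0%N))
  (phi_reg : forall i phi, (1 <= i <= N)%N -> filter_of t net i phi ->
    filter_regular phi (F i) (G i) (Hs i) (p.+1%:R * h / 2)).

(** Factor by which layer i multiplies all three regularity constants and the errors it receives.
    The product over all layers, [gains N], is [calF]. *)
Let gain i : R := (nchan t net i.-1)%:R * p%:R ^+ 2 * F i.
Let gains j : R := \prod_(1 <= i < j.+1) gain i.

Lemma feature0E (s : 'I_n0 -> 'cV[R]_2 -> R) d x B :
  feature h p t net s 0 d x B =
  \sum_(c < n0) \sum_(z <- grid_seq h p)
    phi_in net c d (invmx B *m z) * s c (x - z).
Proof. by apply: eq_bigr => c _; exact: filter_grid_big. Qed.

Lemma featureSE (s : 'I_n0 -> 'cV[R]_2 -> R) j d x B :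
  feature h p t net s j.+1 d x B =
  \sum_(c < mult net j.+1) \sum_(A <- rotgrp_seq R t)
    \sum_(z <- grid_seq h p) phi_mid net j A c d (invmx B *m z) *
      relu (feature h p t net s j c (x - z) (B *m A)).
Proof.
apply: eq_bigr => c _; rewrite rotgrp_big.
by apply: eq_bigr => A _; exact: filter_grid_big.
Qed.

Lemma outputE (s : 'I_n0 -> 'cV[R]_2 -> R) d x :
  output h p t net s d x =
  \sum_(c < mult net N.-2.+1) \sum_(B <- rotgrp_seq R t)
    \sum_(z <- grid_seq h p) phi_out net c d (invmx B *m z) *
      relu (feature h p t net s N.-2 c (x - z) B).
Proof.
apply: eq_bigr => c _; rewrite rotgrp_big.
by apply: eq_bigr => A _; exact: filter_grid_big.
Qed.

Lemma regular_kernel (phi u : 'cV[R]_2 -> R) i (B : 'M[R]_2) F0 G0 H0 :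
  (1 <= i <= N)%N -> filter_of t net i phi -> regular u F0 G0 H0 ->
  regular (fun x => \sum_(z <- grid_seq h p) phi (invmx B *m z) * u (x - z))
    (p%:R ^+ 2 * F i * F0) (p%:R ^+ 2 * F i * G0) (p%:R ^+ 2 * F i * H0).
Proof.
move=> iN fi uR; have [G00 H00 uF _ _] := uR.
have F00 : 0 <= F0 := le_trans (normr_ge0 _) (uF 0).
have Fi := ltW (F_gt0 iN).
have E (C : R) : p%:R ^+ 2 * F i * C = (p ^ 2)%:R * (F i * C).
  by rewrite natrX mulrA.
rewrite !E; apply: regular_sum; rewrite ?size_grid_seq ?mulr_ge0 // => z _.
by apply: regular_scale_shift => //; exact: filter_bounded (phi_reg iN fi) _.
Qed.

Lemma F0_ge0 : 0 <= F 0%N.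
Proof.
by have [_ _ + _ _] := r_reg (Ordinal n0_gt0) => /(_ 0); exact: le_trans.
Qed.

Lemma G0_ge0 : 0 <= G 0%N.
Proof. by have [] := r_reg (Ordinal n0_gt0). Qed.

Lemma H0_ge0 : 0 <= Hs 0%N.
Proof. by have [] := r_reg (Ordinal n0_gt0). Qed.

Lemma gain_ge0 i : (1 <= i <= N)%N -> 0 <= gain i.
Proof. by move=> iN; rewrite /gain !mulr_ge0 ?sqr_ge0 ?(ltW (F_gt0 iN)). Qed.

Lemma gains_ge0 j : (j <= N)%N -> 0 <= gains j.
Proof.
move=> jN; rewrite /gains big_nat; apply: prodr_ge0 => i /andP[i1 ij].
by rewrite gain_ge0 // i1 (leq_trans _ jN).
Qed.

Lemma gainsS j : gains j.+1 = gains j * gain j.+1.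
Proof. by rewrite /gains big_nat_recr. Qed.

(** Filter values are bounded coefficients of translates, so each filter sum costs p^2 F i. Summing
    over channels and rotations completes the gain, and relu costs nothing. *)
Lemma feature_regular j (d : 'I_(mult net j.+1)) B :
  (j.+1 < N)%N ->
  regular (fun x => feature h p t net r j d x B) (gains j.+1 * F 0%N)
    (gains j.+1 * G 0%N) (gains j.+1 * Hs 0%N).
Proof.
elim: j d B => [|j IH] d B jN.
  have -> : (fun x => feature h p t net r 0 d x B) =
      (fun x => \sum_(c < n0) \sum_(z <- grid_seq h p)
        phi_in net c d (invmx B *m z) * r c (x - z)).
    by apply: funext => x; rewrite feature0E.
  have E (C : R) : gains 1 * C = n0%:R * (p%:R ^+ 2 * F 1%N * C).
    by rewrite /gains big_nat1 /gain /nchan /= !mulrA.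
  have i1 : (1 <= 1 <= N)%N := ltnW N_ge2.
  have Fi := ltW (F_gt0 i1).
  rewrite !E; apply: regular_sum => [||||c _].
  - by rewrite /index_enum -enumT size_enum_ord.
  - by rewrite !mulr_ge0 ?sqr_ge0 // F0_ge0.
  - by rewrite !mulr_ge0 ?sqr_ge0 // G0_ge0.
  - by rewrite !mulr_ge0 ?sqr_ge0 // H0_ge0.
  - apply: (@regular_kernel _ (r c)); [exact: i1 | exact: filter_in | exact: r_reg].
have -> : (fun x => feature h p t net r j.+1 d x B) =
    (fun x => \sum_(c < mult net j.+1) \sum_(A <- rotgrp_seq R t)
      \sum_(z <- grid_seq h p) phi_mid net j A c d (invmx B *m z) *
      relu (feature h p t net r j c (x - z) (B *m A))).
  by apply: funext => x; rewrite featureSE.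
have E (C : R) : gains j.+2 * C = (mult net j.+1)%:R *
    (t%:R * (p%:R ^+ 2 * F j.+2 * (gains j.+1 * C))).
  by rewrite gainsS /gain /nchan /= natrM; ring.
have iN : (1 <= j.+2 <= N)%N := ltnW jN.
have Fi := ltW (F_gt0 iN).
have gj : 0 <= gains j.+1 := gains_ge0 (ltnW (ltnW jN)).
rewrite !E; apply: regular_sum => [||||c _].
- by rewrite /index_enum -enumT size_enum_ord.
- by rewrite !mulr_ge0 ?sqr_ge0 // F0_ge0.
- by rewrite !mulr_ge0 ?sqr_ge0 // G0_ge0.
- by rewrite !mulr_ge0 ?sqr_ge0 // H0_ge0.
apply: regular_sum => [||||A /rotgrp_seqP AS].
- exact: size_rotgrp_seq.
- by rewrite !mulr_ge0 ?sqr_ge0 // F0_ge0.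
- by rewrite !mulr_ge0 ?sqr_ge0 // G0_ge0.
- by rewrite !mulr_ge0 ?sqr_ge0 // H0_ge0.
apply: (@regular_kernel _ (fun x => relu (feature h p t net r j c x (B *m A)))).
- exact: iN.
- exact: filter_mid.
- by apply: regular_relu; apply: IH; exact: ltnW.
Qed.

(** * Accumulation of the equivariance error over the layers *)

Context (theta kappa eta : R) (b : 'cV[R]_2)
  (theta_kappa : `|theta - kappa| <= eta).

Let fr c := transf theta b (r c).
(** Error created in layer i relative to the accumulated gain: a part due to the angle theta - kappa
    and a part due to the quadrature. *)
Let layer_error i : R := 2 * eta * (p%:R * h) * G 0%N +
  4 * h ^+ 2 * (F 0%N * Hs i / F i + 2 * (G i / F i * G 0%N) + Hs 0%N).
Let errors j : R := \sum_(1 <= i < j.+1) layer_error i.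

Lemma layer_kernel_error (phi u v : 'cV[R]_2 -> R) i beta x E :
  (1 <= i <= N)%N -> filter_of t net i phi ->
  regular u (gains i.-1 * F 0%N) (gains i.-1 * G 0%N) (gains i.-1 * Hs 0%N) ->
  (forall z, `|v z - u (x - rot (- theta) *m z)| <= gains i.-1 * E) ->
  `|\sum_(z <- grid_seq h p) phi (invmx (rot beta) *m z) * v z -
    \sum_(z <- grid_seq h p) phi (invmx (rot (beta - kappa)) *m z) * u (x - z)|
  <= p%:R ^+ 2 * F i * (gains i.-1 * (E + layer_error i)).
Proof.
move=> iN fi uR vE.
have := kernel_error beta h_gt0 p_gt0 (F_gt0 iN) (phi_reg iN fi) uR
  theta_kappa vE.
move=> /le_trans; apply; rewrite le_eqVlt; apply/orP; left; apply/eqP.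
by rewrite /layer_error; ring.
Qed.

Lemma transf_rot c x z :
  fr c (rot theta *m x + b - z) = r c (x - rot (- theta) *m z).
Proof.
rewrite /fr /transf rotV addrAC addrK mulmxBr; congr (r c (_ - _)).
by rewrite -{2}[theta]opprK rotKV.
Qed.

Lemma rot_shift (x z : 'cV[R]_2) :
  rot theta *m x + b - z = rot theta *m (x - rot (- theta) *m z) + b.
Proof. by rewrite mulmxBr rotKV addrAC. Qed.

(** Transforming the input by theta acts on features, up to the errors, by moving the point and
    turning the group coordinate by - kappa. The angle beta is arbitrary so that the induction
    applies to rot beta times A. The first layer inherits no error, and relu, being 1-Lipschitz,
    creates none. *)
Lemma feature_error j (d : 'I_(mult net j.+1)) beta x :
  (j.+1 < N)%N ->
  `|feature h p t net fr j d (rot theta *m x + b) (rot beta) -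
    feature h p t net r j d x (rot (beta - kappa))|
  <= gains j.+1 * errors j.+1.
Proof.
elim: j d beta x => [|j IH] d beta x jN.
  have i1 : (1 <= 1 <= N)%N := ltnW N_ge2.
  rewrite !feature0E -sumrB; apply: le_trans (ler_norm_sum _ _ _) _.
  have -> : gains 1 * errors 1 = \sum_(c < n0)
      p%:R ^+ 2 * F 1%N * (gains 0 * (0 + layer_error 1)).
    rewrite sumr_const card_ord /errors /gains big_nat1 big_nat1 big_geq //.
    by rewrite mul1r add0r /gain /nchan /= -[RHS]mulr_natl !mulrA.
  apply: ler_sum => c _.
  have g0 : gains 0 = 1 by rewrite /gains big_geq.
  apply: (@layer_kernel_error _ (r c)
    (fun z => fr c (rot theta *m x + b - z))) => //.
  - exact: filter_in.
  - by rewrite /= g0 !mul1r.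
  - by move=> z; rewrite transf_rot subrr normr0 mulr0.
have iN : (1 <= j.+2 <= N)%N := ltnW jN.
rewrite !featureSE -sumrB; apply: le_trans (ler_norm_sum _ _ _) _.
have -> : gains j.+2 * errors j.+2 = \sum_(c < mult net j.+1) t%:R *
    (p%:R ^+ 2 * F j.+2 * (gains j.+1 * (errors j.+1 + layer_error j.+2))).
  rewrite sumr_const card_ord gainsS /errors [in LHS]big_nat_recr //=.
  by rewrite /gain /nchan /= natrM -[RHS]mulr_natl; ring.
apply: ler_sum => c _; rewrite -sumrB.
have err A : A \in rotgrp_seq R t ->
  `|\sum_(z <- grid_seq h p) phi_mid net j A c d (invmx (rot beta) *m z) *
      relu (feature h p t net fr j c (rot theta *m x + b - z) (rot beta *m A)) -
    \sum_(z <- grid_seq h p) phi_mid net j A c d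
        (invmx (rot (beta - kappa)) *m z) *
      relu (feature h p t net r j c (x - z) (rot (beta - kappa) *m A))|
  <= p%:R ^+ 2 * F j.+2 * (gains j.+1 * (errors j.+1 + layer_error j.+2)).
  move=> AS; have [a aE] := rotgrp_seq_rot AS; move: AS => /rotgrp_seqP AS.
  apply: (@layer_kernel_error _
    (fun y => relu (feature h p t net r j c y (rot (beta - kappa) *m A)))
    (fun z => relu (feature h p t net fr j c (rot theta *m x + b - z)
      (rot beta *m A)))) => //.
  - exact: filter_mid.
  - by apply: regular_relu; apply: feature_regular; exact: ltnW.
  - move=> z; apply: le_trans (relu_lip _ _) _.
    rewrite rot_shift aE !rotD addrAC; apply: IH; exact: ltnW.
apply: norm_sum_le => //; first exact: size_rotgrp_seq.
(* Nonnegativity of the bound is read off at one group element, the full turn k = t. *)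
have A0 : rot (2 * pi * t%:R / t%:R) \in rotgrp_seq R t.
  by apply/rotgrp_seqP; exists t => //=; rewrite t_gt0 leqnn.
exact: le_trans (normr_ge0 _) (err _ A0).
Qed.

(** Here kappa must be a group angle: the output layer sums over the whole group, and reindexing by
    rot (- kappa) absorbs the turned group coordinate. *)
Lemma output_error k d x : (1 <= k <= t)%N -> kappa = 2 * pi * k%:R / t%:R ->
  `|output h p t net fr d (rot theta *m x + b) - output h p t net r d x|
  <= gains N * errors N.
Proof.
move=> kt kE; rewrite !outputE.
have NE : N.-1.+1 = N by rewrite prednK // ltnW.
have iN : (1 <= N <= N)%N by rewrite leqnn andbT ltnW.
have N1 : N.-1 = N.-2.+1 by rewrite prednK // -ltnS NE.
have g1 : gains N.-1 = gains N.-2.+1 by rewrite N1.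
have e1 : errors N.-1 = errors N.-2.+1 by rewrite N1.
rewrite -sumrB; apply: le_trans (ler_norm_sum _ _ _) _.
have -> : gains N * errors N = \sum_(c < mult net N.-2.+1) t%:R *
    (p%:R ^+ 2 * F N * (gains N.-1 * (errors N.-2.+1 + layer_error N))).
  have gN : gains N = gains N.-1 * gain N by rewrite -{1}NE gainsS NE.
  have eN : errors N = errors N.-1 + layer_error N.
    by rewrite -{1}NE /errors big_nat_recr //= NE.
  have nc : nchan t net N.-1 = (t * mult net N.-2.+1)%N.
    by rewrite /nchan {1}N1 /= -N1.
  rewrite sumr_const card_ord gN eN e1 /gain nc natrM -[RHS]mulr_natl; ring.
apply: ler_sum => c _.
rewrite -(rotgrp_translate (fun B => \sum_(z <- grid_seq h p)
  phi_out net c d (invmx B *m z) *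
  relu (feature h p t net r N.-2 c (x - z) B)) kt) -kE -sumrB.
have err B : B \in rotgrp_seq R t ->
  `|\sum_(z <- grid_seq h p) phi_out net c d (invmx B *m z) *
      relu (feature h p t net fr N.-2 c (rot theta *m x + b - z) B) -
    \sum_(z <- grid_seq h p) phi_out net c d (invmx (rot (- kappa) *m B) *m z) *
      relu (feature h p t net r N.-2 c (x - z) (rot (- kappa) *m B))|
  <= p%:R ^+ 2 * F N * (gains N.-1 * (errors N.-2.+1 + layer_error N)).
  move=> BS; have [a ->] := rotgrp_seq_rot BS; rewrite rotD [- kappa + a]addrC.
  have jN : (N.-2.+1 < N)%N by rewrite -N1 NE.
  apply: (@layer_kernel_error _
    (fun y => relu (feature h p t net r N.-2 c y (rot (a - kappa))))
    (fun z => relu (feature h p t net fr N.-2 c (rot theta *m x + b - z)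
      (rot a)))) => //.
  - exact: filter_out.
  - by rewrite g1; apply: regular_relu; exact: feature_regular.
  - move=> z; apply: le_trans (relu_lip _ _) _.
    by rewrite rot_shift g1; exact: feature_error.
apply: norm_sum_le => //; first exact: size_rotgrp_seq.
have A0 : rot (2 * pi * t%:R / t%:R) \in rotgrp_seq R t.
  by apply/rotgrp_seqP; exists t => //=; rewrite t_gt0 leqnn.
exact: le_trans (normr_ge0 _) (err _ A0).
Qed.

(** The signs of [G i] and [Hs i] are read off a filter of layer i. A hidden layer might have no
    channels, but then a factor of [calF] is 0. *)
Lemma filter_exists i : (0 < nN)%N -> calF p t net F != 0 -> (1 <= i <= N)%N ->
  exists phi, filter_of t net i phi.
Proof.
move=> nN0 F_neq0 /andP[i1 iN].
have mult_gt0 j : (1 <= j < N)%N -> (0 < mult net j)%N.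
  move=> /andP[j1 jN]; move: F_neq0; rewrite /calF prodf_seq_neq0.
  move=> /allP/(_ j.+1); rewrite mem_index_iota /= ltnS jN => /(_ isT).
  rewrite !mulf_eq0 !negb_or => /andP[/andP[+ _] _].
  rewrite /nchan; case: j j1 jN => // j _ _ /=.
  by rewrite pnatr_eq0 muln_eq0 negb_or lt0n => /andP[].
have [<-|ltN] := eqVneq N i.
  have c : (0 < mult net N.-2.+1)%N.
    by apply: mult_gt0; clear -N_ge2; lia.
  by exists (phi_out net (Ordinal c) (Ordinal nN0)); exact: filter_out.
have {ltN}iN : (i < N)%N by rewrite ltn_neqAle eq_sym ltN.
case: i i1 iN => // -[_ N1|j _ jN].
  have d : (0 < mult net 1)%N by exact: mult_gt0.
  by exists (phi_in net (Ordinal n0_gt0) (Ordinal d)); exact: filter_in.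
have c : (0 < mult net j.+1)%N by apply: mult_gt0; exact: ltnW jN.
have d : (0 < mult net j.+2)%N by exact: mult_gt0.
exists (phi_mid net j (rot (2 * pi * t%:R / t%:R)) (Ordinal c) (Ordinal d)).
by apply: filter_mid => //; exists t => //=; rewrite t_gt0 leqnn.
Qed.

(** The quadrature factor 4 is at most 2 N as N >= 2, and eta = 2 pi / t gives exactly the summand 2
    N of [const2]. The other terms of both constants are nonnegative. *)
Lemma errors_le (H W : nat) : (0 < nN)%N -> eta = 2 * pi / t%:R ->
  gains N * errors N <= const1 p t net F G Hs * h ^+ 2 +
    const2 H W p t net F G * p%:R * h * t%:R^-1.
Proof.
move=> nN0 etaE.
have gF : gains N = calF p t net F by [].
rewrite /const1 /const2 -gF.
(* If [gains N] is 0, both sides are 0; otherwise every layer has a filter and the constants have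
   known signs. *)
have [g0|g_neq0] := eqVneq (gains N) 0.
  by rewrite g0 !(mul0r, mulr0) addr0.
have fil i (iN : (1 <= i <= N)%N) : 0 <= G i /\ 0 <= Hs i.
  by have [phi /(phi_reg iN)[]] := filter_exists nN0 g_neq0 iN.
have gN : 0 <= gains N by exact: gains_ge0.
have FF := F0_ge0; have GG := G0_ge0; have HH := H0_ge0.
have h2 : 0 <= h ^+ 2 by exact: sqr_ge0.
have pi0 : 0 < pi :> R by exact: pi_gt0.
pose T i : R := Hs i * F 0%N / F i
     + 2 * (G i / F i) * (\sum_(1 <= m < i) G m * F 0%N / F m)
     + 2 * (G i * G 0%N / F i) + Hs 0%N.
have sT : \sum_(1 <= i < N.+1)
    (F 0%N * Hs i / F i + 2 * (G i / F i * G 0%N) + Hs 0%N) <=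
    \sum_(1 <= i < N.+1) T i.
  rewrite big_nat [leRHS]big_nat; apply: ler_sum => i /andP[i1 iN].
  have iN' : (1 <= i <= N)%N by rewrite i1.
  have Fi := ltW (F_gt0 iN'); have [Gi Hi] := fil i iN'.
  have S0 : 0 <= 2 * (G i / F i) * (\sum_(1 <= m < i) G m * F 0%N / F m).
    apply: mulr_ge0; first by rewrite mulr_ge0 ?divr_ge0.
    rewrite big_nat; apply: sumr_ge0 => m /andP[m1 mi].
    have mN : (1 <= m <= N)%N by rewrite m1 ltnW // (leq_trans mi) // -ltnS.
    have [Gm _] := fil m mN.
    by rewrite divr_ge0 ?mulr_ge0 ?(ltW (F_gt0 mN)).
  rewrite /T; move: S0; set S := 2 * _ * _ => S0.
  have -> : F 0%N * Hs i / F i = Hs i * F 0%N / F i by ring.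
  have -> : 2 * (G i / F i * G 0%N) = 2 * (G i * G 0%N / F i) by ring.
  lra.
have sT0 : 0 <= \sum_(1 <= i < N.+1) T i.
  apply: le_trans sT; rewrite big_nat sumr_ge0 // => i /andP[i1 iN].
  have iN' : (1 <= i <= N)%N by rewrite i1.
  have Fi := ltW (F_gt0 iN'); have [Gi Hi] := fil i iN'.
  by rewrite !addr_ge0 ?mulr_ge0 ?divr_ge0 ?mulr_ge0 ?invr_ge0.
have -> : errors N = N%:R * (2 * eta * (p%:R * h) * G 0%N) +
    4 * h ^+ 2 * \sum_(1 <= i < N.+1)
      (F 0%N * Hs i / F i + 2 * (G i / F i * G 0%N) + Hs 0%N).
  rewrite /errors /layer_error big_split /= sumr_const_nat subSS subn0.
  by rewrite -mulr_sumr -[X in X + _ = _]mulr_natl.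
rewrite mulrDr addrC; apply: lerD.
  have N2 : 2 <= N%:R :> R by rewrite (ler_nat _ 2).
  rewrite -/(T _).
  have -> : 2 * N%:R * gains N * (\sum_(1 <= i < N.+1) T i) * h ^+ 2 =
    gains N * ((2 * N%:R) * h ^+ 2 * \sum_(1 <= i < N.+1) T i) by ring.
  rewrite ler_wpM2l //; apply: le_trans (_ : 4 * h ^+ 2 * \sum_(1 <= i < N.+1) T i <= _).
    by rewrite ler_wpM2l // mulr_ge0.
  by rewrite ler_wpM2r // ler_wpM2r //; lra.
rewrite etaE.
have -> : 2 * pi * G 0%N * gains N * (2 * (maxn H W)%:R / p%:R + 2 * N%:R) *
    p%:R * h / t%:R = gains N * (N%:R * (2 * (2 * pi / t%:R) * (p%:R * h) * G 0%N)
    + 2 * pi * G 0%N * (2 * (maxn H W)%:R / p%:R) * p%:R * h / t%:R) by ring.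
rewrite ler_wpM2l // lerDl.
by rewrite !mulr_ge0 ?invr_ge0 ?(ltW pi0) ?(ltW h_gt0).
Qed.

End network.

(** * From bounds on derivatives to the equivariance error of the network *)

Theorem theorem1 (R : realType) (H W p t n0 nN N : nat) (h : R)
    (H_gt0 : (0 < H)%N) (W_gt0 : (0 < W)%N) (p_gt0 : (0 < p)%N)
    (t_gt0 : (0 < t)%N) (n0_gt0 : (0 < n0)%N) (nN_gt0 : (0 < nN)%N)
    (N_ge2 : (2 <= N)%N) (h_gt0 : 0 < h)
    (r : 'I_n0 -> 'cV[R]_2 -> R) (net : eqcnn R N n0 nN)
    (F G Hs : nat -> R)
    (r_smooth : forall c, smooth (r c))
    (phi_smooth : forall i phi, filter_of t net i phi -> smooth phi)
    (F_gt0 : forall i, (1 <= i <= N)%N -> 0 < F i)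
    (r_bound : forall c x,
      [/\ `|r c x| <= F 0%N,
          enorm (gradient (r c) x) <= G 0%N &
          opnorm (hessian (r c) x) <= Hs 0%N])
    (phi_bound : forall i phi x, (1 <= i <= N)%N -> filter_of t net i phi ->
      [/\ `|phi x| <= F i,
          enorm (gradient phi x) <= G i &
          opnorm (hessian phi x) <= Hs i])
    (phi_support : forall i phi x, (1 <= i <= N)%N -> filter_of t net i phi ->
      p.+1%:R * h / 2 <= enorm x -> phi x = 0)
    (theta : R) (theta_ge0 : 0 <= theta) (theta_le2pi : theta <= 2 * pi)
    (b : 'cV[R]_2) :
  let g (s : 'I_n0 -> 'cV[R]_2 -> R) := output h p t net s in
  let f (s : 'cV[R]_2 -> R) := transf theta b s in
  let finv (s : 'cV[R]_2 -> R) := transf_inv theta b s in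
  maxnorm (image_of H W h (fun d => finv (g (fun c => f (r c)) d))
           - image_of H W h (g r))
  <= const1 p t net F G Hs * h ^+ 2 + const2 H W p t net F G * p%:R * h * t%:R^-1.
Proof.
cbv zeta.
(* Smoothness enters at order two, where it makes the function and its partial derivatives
   differentiable. *)
have smooth_diff (u : 'cV[R]_2 -> R) : smooth u ->
    (forall x, differentiable u x) /\
    (forall i x, differentiable (partial i u) x).
  by move=> /(_ 2%N)[ud ud2]; split => // i; have [] := ud2 i.
have r_reg c : regular (r c) (F 0%N) (G 0%N) (Hs 0%N).
  have [rd rd2] := smooth_diff _ (r_smooth c).
  have G0 : 0 <= G 0%N by have [_ + _] := r_bound c 0; exact/le_trans/enorm_ge0.
  have H0 : 0 <= Hs 0%N.
    by have [_ _] := r_bound c 0; exact/le_trans/opnorm_ge0.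
  have lip : elipschitz (r c) (G 0%N).
    by apply: C1_elipschitz => // x; have [] := r_bound c x.
  split => // [x|]; first by have [] := r_bound c x.
  apply: second_diff_line_var => //; apply: C2_second_diff => // x.
  by have [] := r_bound c x.
have phi_reg i phi : (1 <= i <= N)%N -> filter_of t net i phi ->
    filter_regular phi (F i) (G i) (Hs i) (p.+1%:R * h / 2).
  move=> iN fi; have [pd pd2] := smooth_diff _ (phi_smooth _ _ fi).
  have bnd x := phi_bound i phi x iN fi.
  split => [|||||x].
  - by have [_ + _] := bnd 0; exact/le_trans/enorm_ge0.
  - by have [_ _] := bnd 0; exact/le_trans/opnorm_ge0.
  - by move=> x; have [] := bnd x.
  - by apply: C1_elipschitz => // x; have [] := bnd x.
  - by apply: C2_second_diff => // x; have [] := bnd x.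
  - exact: phi_support iN fi.
have [k kt thk] := nearest_rotation t_gt0 theta_ge0 theta_le2pi.
set RHS := (X in _ <= X).
(* The bound holds at every point of the plane, in particular at the grid points. *)
have entry d x : `|transf_inv theta b
    (output h p t net (fun c => transf theta b (r c)) d) x -
    output h p t net r d x| <= RHS.
  apply: le_trans (output_error h_gt0 p_gt0 t_gt0 n0_gt0 N_ge2 F_gt0 r_reg
    phi_reg b thk d x kt erefl) _.
  exact: errors_le.
(* The maximum in [maxnorm] starts from 0, so the bound must be nonnegative; this is read off an
   existing output channel. *)
have RHS0 : 0 <= RHS := le_trans (normr_ge0 _) (entry (Ordinal nN_gt0) 0).
rewrite /maxnorm; apply: bigmax_le => // q _; rewrite !ffunE; exact: entry.
Qed.
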